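(* Let $n\geq 3$ be an integer, let $n/2<\beta\leq n-1$, and let $\sigma_\beta$ be defined by $\log(\sigma_\beta)=\frac{2(n-2)}{2\beta-n}$. Then for all $f\in\mathcal{C}_c^\infty(\mathbb{R}^n)$, $$\operatorname{Ent}_{\mu_\beta}(f^2)\leq\frac{4}{2\beta-n}\int_{\mathbb{R}^n}|\nabla f|^2\,\omega\left(\log(\sigma_\beta)+\log(\omega)\right)d\mu_\beta.$$
   Context: $\mathcal{C}_c^\infty(\mathbb{R}^n)$ is the set of smooth compactly supported functions on $\mathbb{R}^n$. For $\beta>n/2$, $\mu_\beta$ is the generalised Cauchy probability measure on $\mathbb{R}^n$ with density proportional to $(1+|x|^2)^{-\beta}$, where $|\cdot|$ is the Euclidean norm. $\omega(x)=1+|x|^2$. For a probability measure $\nu$ and $g\ge0$, $\operatorname{Ent}_\nu(g)=\int g\log g\,d\nu-\left(\int g\,d\nu\right)\log\left(\int g\,d\nu\right)$ (with $0\log 0=0$). *)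

(* Defs.v *)
From HB Require Import structures.
From mathcomp Require Import all_boot all_order all_algebra.
From mathcomp Require Import all_classical all_reals all_analysis.
From mathcomp Require Import measurable_realfun.

Set Implicit Arguments.
Unset Strict Implicit.
Unset Printing Implicit Defensive.

Import Order.TTheory GRing.Theory Num.Theory.
Import numFieldNormedType.Exports.

Local Open Scope classical_set_scope.
Local Open Scope ring_scope.

(* Product sigma-algebra on 'rV[R]_n, generated by the coordinate functions,
   as the library does for n.-tuple. *)
Section measurable_rV.
Context (R : realType) (n : nat).

Let coord (i : 'I_n) (x : 'rV[R]_n) : measurableTypeR R := x ord0 i.

Let rV_set0 : g_sigma_preimage coord set0.
Proof. exact: sigma_algebra0. Qed.

Let rV_setC A : g_sigma_preimage coord A -> g_sigma_preimage coord (~` A).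
Proof. exact: sigma_algebraC. Qed.

Let rV_bigcup (F : (set 'rV[R]_n)^nat) :
  (forall i, g_sigma_preimage coord (F i)) ->
  g_sigma_preimage coord (\bigcup_i F i).
Proof. exact: sigma_algebra_bigcup. Qed.

HB.instance Definition _ :=
  @isMeasurable.Build (measure_tuple_display default_measure_display)
    'rV[R]_n (g_sigma_preimage coord) rV_set0 rV_setC rV_bigcup.
End measurable_rV.

Section lebesgue_rV.
Context {R : realType}.

Definition cons_rV n (p : measurableTypeR R * 'rV[R]_n) : 'rV[R]_n.+1 :=
  row_mx (p.1)%:M p.2.

Fixpoint lebesgue_rV n : set 'rV[R]_n -> \bar R :=
  match n with
  | 0 => \d_ (0 : 'rV[R]_0)
  | n'.+1 => pushforward (lebesgue_measure \x @lebesgue_rV n')%E (@cons_rV n')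
  end.

Lemma measurable_coord_rV n (i : 'I_n) :
  measurable_fun [set: 'rV[R]_n]
    (fun x : 'rV[R]_n => x ord0 i : measurableTypeR R).
Proof.
move=> _ Y mY; rewrite setTI; apply: sub_sigma_algebra => /=.
rewrite -bigcup_seq/=; exists i => /=; first by rewrite mem_index_enum.
by exists Y => //; rewrite setTI.
Qed.

Lemma measurable_fun_rVP d (T : measurableType d) n (f : T -> 'rV[R]_n) :
  measurable_fun [set: T] f <->
  forall i, measurable_fun [set: T] (fun x => f x ord0 i : measurableTypeR R).
Proof.
split=> [mf i|mf].
  exact: (measurableT_comp (measurable_coord_rV i) mf).
suff prefS : g_sigma_preimage
    (fun i (x : T) => f x ord0 i : measurableTypeR R) `<=` measurable.
  move=> _ A mA; apply: prefS.
  rewrite (@g_sigma_preimage_comp _ _ _ 'rV[R]_n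
    (fun i (x : 'rV[R]_n) => x ord0 i : measurableTypeR R)).
  by exists A.
apply: smallest_sub; first exact: sigma_algebra_measurable.
case: n => [|n] in f mf *; first by rewrite big_ord0.
rewrite -bigcup_mkord_ord; apply: bigcup_sub => i Ii.
by move=> A [B mB <-]; exact: mf.
Qed.

Lemma cons_rV0 n (p : measurableTypeR R * 'rV[R]_n) : cons_rV p ord0 ord0 = p.1.
Proof.
have -> : (ord0 : 'I_n.+1) = lshift n (ord0 : 'I_1) by exact/val_inj.
by rewrite [LHS](@row_mxEl _ 1 1 n) mxE eqxx mulr1n.
Qed.

Lemma cons_rVS n (p : measurableTypeR R * 'rV[R]_n) (i : 'I_n) :
  cons_rV p ord0 (lift ord0 i) = p.2 ord0 i.
Proof.
have -> : lift ord0 i = rshift 1 i by exact/val_inj.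
by rewrite [LHS](@row_mxEr _ 1 1 n).
Qed.

Lemma measurable_cons_rV n : measurable_fun setT (@cons_rV n).
Proof.
apply/measurable_fun_rVP => i.
case: (unliftP ord0 i) => [j|] ->.
  rewrite (_ : (fun _ => _) = (fun x : 'rV[R]_n => x ord0 j) \o snd); last first.
    by apply/funext => p /=; rewrite cons_rVS.
  exact: (measurableT_comp (measurable_coord_rV j) measurable_snd).
rewrite (_ : (fun _ => _) = fst); first exact: measurable_fst.
by apply/funext => p /=; rewrite cons_rV0.
Qed.

Definition uncons_rV n (x : 'rV[R]_n.+1) : measurableTypeR R * 'rV[R]_n :=
  (x ord0 ord0, \row_i x ord0 (lift ord0 i)).

Lemma cons_rVK n : cancel (@cons_rV n) (@uncons_rV n).
Proof.
move=> [a v]; rewrite /uncons_rV cons_rV0; congr pair.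
by apply/rowP => i; rewrite mxE cons_rVS.
Qed.

Lemma uncons_rVK n : cancel (@uncons_rV n) (@cons_rV n).
Proof.
move=> x; apply/rowP => i; case: (unliftP ord0 i) => [j|] ->.
  by rewrite cons_rVS mxE.
by rewrite cons_rV0.
Qed.

Lemma measurable_uncons_rV n : measurable_fun setT (@uncons_rV n).
Proof.
apply: measurable_fun_pair; first exact: measurable_coord_rV.
apply/measurable_fun_rVP => i.
rewrite (_ : (fun _ => _) = (fun x : 'rV[R]_n.+1 => x ord0 (lift ord0 i))).
  exact: measurable_coord_rV.
by apply/funext => x; rewrite mxE.
Qed.

End lebesgue_rV.

Section lebesgue_rV_step.
Context (R : realType) (n : nat).
Variable m : {sigma_finite_measure set 'rV[R]_n -> \bar R}.

Definition push_cons_rV : set 'rV[R]_n.+1 -> \bar R :=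
  pushforward (lebesgue_measure \x m)%E (@cons_rV R n).

Local Notation M := push_cons_rV.

Let mf := @measurable_cons_rV R n.

Let M0 : M set0 = 0%E. Proof. exact: measure0. Qed.

Let M_ge0 A : (0 <= M A)%E. Proof. exact: measure_ge0. Qed.

Let M_sigma_additive : semi_sigma_additive M.
Proof. exact: measure_semi_sigma_additive. Qed.

HB.instance Definition _ := isMeasure.Build _ _ _ M M0 M_ge0 M_sigma_additive.

Let M_sigma_finite : sigma_finite setT M.
Proof.
have /sigma_finiteP[F [TF ndF Foo]] := sigma_finiteT (@lebesgue_measure R).
have /sigma_finiteP[G [TG ndG Goo]] := sigma_finiteT m.
exists (fun k => @uncons_rV R n @^-1` (F k `*` G k)).
  apply/esym; rewrite -subTset => x _.
  have [i _ Fi] : (\bigcup_i F i) (uncons_rV x).1 by rewrite -TF.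
  have [j _ Gj] : (\bigcup_i G i) (uncons_rV x).2 by rewrite -TG.
  exists (maxn i j) => //; split.
    by move: (Fi); exact/subsetPset/ndF/leq_maxl.
  by move: (Gj); exact/subsetPset/ndG/leq_maxr.
move=> k; have [mFk Fk] := Foo k; have [mGk Gk] := Goo k; split.
  rewrite -[X in measurable X]setTI; apply: measurable_uncons_rV => //.
  exact: measurableX.
rewrite /push_cons_rV /pushforward (_ : _ @^-1` _ = F k `*` G k).
  by rewrite product_measure1E// lte_mul_pinfty// ge0_fin_numE.
by apply/funext => p; rewrite /preimage /mkset cons_rVK.
Qed.

HB.instance Definition _ :=
  Measure_isSigmaFinite.Build _ _ _ M M_sigma_finite.

Definition lebesgue_rV_step :
  {sigma_finite_measure set 'rV[R]_n.+1 -> \bar R} := M.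

End lebesgue_rV_step.

Section lebesgue_rV_measure.
Context {R : realType}.

Lemma lebesgue_rV_sigma_finite_measure n :
  {m : {sigma_finite_measure set 'rV[R]_n -> \bar R} |
    @lebesgue_rV R n = m :> (set 'rV[R]_n -> \bar R)}.
Proof.
elim: n => [|n [m mE]]; first by exists (\d_ (0 : 'rV[R]_0)).
by exists (lebesgue_rV_step m); rewrite /= mE.
Qed.

Variable n : nat.

Let leb0 : @lebesgue_rV R n set0 = 0%E.
Proof. by have [m ->] := lebesgue_rV_sigma_finite_measure n. Qed.

Let leb_ge0 A : (0 <= @lebesgue_rV R n A)%E.
Proof. by have [m ->] := lebesgue_rV_sigma_finite_measure n. Qed.

Let leb_sigma_additive : semi_sigma_additive (@lebesgue_rV R n).
Proof.
have [m ->] := lebesgue_rV_sigma_finite_measure n.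
exact: measure_semi_sigma_additive.
Qed.

HB.instance Definition _ := isMeasure.Build _ _ _ (@lebesgue_rV R n)
  leb0 leb_ge0 leb_sigma_additive.

Let leb_sigma_finite : sigma_finite setT (@lebesgue_rV R n).
Proof.
by have [m ->] := lebesgue_rV_sigma_finite_measure n; exact: sigma_finiteT.
Qed.

HB.instance Definition _ :=
  Measure_isSigmaFinite.Build _ _ _ (@lebesgue_rV R n) leb_sigma_finite.

End lebesgue_rV_measure.

Lemma lebesgue_rV_box (R : realType) n (A : 'I_n -> set (measurableTypeR R)) :
  (forall i, measurable (A i)) ->
  lebesgue_rV [set x : 'rV[R]_n | forall i, A i (x ord0 i)] =
  (\prod_(i < n) lebesgue_measure (A i))%E.
Proof.
elim: n A => [|n IH] A mA.
  by rewrite big_ord0 /= diracE mem_set//= => -[].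
rewrite big_ord_recl -IH//= -product_measure1E//; last first.
  rewrite (_ : [set _ | _] = \bigcap_(i in setT)
    ((fun x : 'rV[R]_n => x ord0 i : measurableTypeR R) @^-1` A (lift ord0 i))).
    apply: fin_bigcap_measurable => // i _.
    by rewrite -[X in measurable X]setTI; exact: measurable_coord_rV.
  by apply/seteqP; split => x /= Ax i => [_|]; exact: Ax.
rewrite /pushforward; congr product_measure1.
apply/seteqP; split => [p /= Ap|p /= [A0 AS] i].
  split => [|i]; first by have := Ap ord0; rewrite cons_rV0.
  by have := Ap (lift ord0 i); rewrite cons_rVS.
by case: (unliftP ord0 i) => [j|] ->; rewrite ?cons_rVS ?cons_rV0.
Qed.

Section smooth.
Context {R : realType} {n : nat}.
Implicit Types (f : 'rV[R]_n -> R) (x : 'rV[R]_n).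

Definition partial (i : 'I_n) f : 'rV[R]_n -> R :=
  fun x => 'D_(delta_mx ord0 i) f x.

(* C^infinity: s lists the directions of an iterated partial derivative. *)
Definition smooth f := forall s : seq 'I_n,
  continuous (foldr partial f s) /\
  forall i x, derivable (foldr partial f s) x (delta_mx ord0 i).

Definition compactly_supported f := compact (closure [set x | f x != 0]).

Definition grad f x : 'rV[R]_n := \row_i partial i f x.

(* The library's norm `|x| on 'rV[R]_n is the sup norm. *)
Definition enorm x : R := Num.sqrt (\sum_i x ord0 i ^+ 2).

Definition omega x : R := 1 + enorm x ^+ 2.

End smooth.

Section cauchy.
Context {R : realType} {n : nat} (beta : R).

Definition cauchy_num (A : set 'rV[R]_n) : \bar R :=
  (\int[lebesgue_rV (n:=n)]_(x in A) (omega x `^ (- beta))%:E)%E.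

(* For n > 0 and beta <= n%:R / 2 the total mass of cauchy_num is +oo, which
   fine sends to 0, so that cauchy_measure is then the null measure. *)
Definition cauchy_measure (A : set 'rV[R]_n) : \bar R :=
  ((fine (cauchy_num setT))^-1%:E * cauchy_num A)%E.

Lemma measurable_omega : measurable_fun setT (@omega R n).
Proof.
apply: measurable_funD => //.
rewrite (_ : (fun _ => _) = (fun x : 'rV[R]_n => \sum_i x ord0 i ^+ 2)).
  apply: measurable_sum => i.
  exact: (measurable_funX 2 (measurable_coord_rV i)).
by apply/funext => x; rewrite sqr_sqrtr// sumr_ge0// => i _; exact: sqr_ge0.
Qed.

Let cauchy_num0 : cauchy_num set0 = 0%E.
Proof. exact: integral_set0. Qed.

Let cauchy_num_ge0 A : (0 <= cauchy_num A)%E.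
Proof. by apply: integral_ge0 => x _; rewrite lee_fin powR_ge0. Qed.

Let cauchy_num_sigma_additive : semi_sigma_additive cauchy_num.
Proof.
move=> F mF tF mUF; rewrite /cauchy_num ge0_integral_bigcup//; first last.
- by move=> x _; rewrite lee_fin powR_ge0.
- apply/measurable_EFinP/measurable_funTS.
  exact: (measurableT_comp (measurable_powR (- beta)) measurable_omega).
apply: is_cvg_ereal_nneg_natsum_cond => k _ _.
by apply: integral_ge0 => x _; rewrite lee_fin powR_ge0.
Qed.

HB.instance Definition _ := isMeasure.Build _ _ _ cauchy_num
  cauchy_num0 cauchy_num_ge0 cauchy_num_sigma_additive.

Let cauchy_mscale :
  cauchy_measure =
  mscale (NngNum (fine_ge0 (measure_ge0 cauchy_num setT)))%:num^-1%:nng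
    cauchy_num.
Proof. by []. Qed.

Let cauchy0 : cauchy_measure set0 = 0%E.
Proof. by rewrite cauchy_mscale. Qed.

Let cauchy_ge0 A : (0 <= cauchy_measure A)%E.
Proof. by rewrite cauchy_mscale. Qed.

Let cauchy_sigma_additive : semi_sigma_additive cauchy_measure.
Proof. by rewrite cauchy_mscale; exact: measure_semi_sigma_additive. Qed.

HB.instance Definition _ := isMeasure.Build _ _ _ cauchy_measure
  cauchy0 cauchy_ge0 cauchy_sigma_additive.

End cauchy.

(* Extended-real valued: lne 0 = -oo and 0 * -oo = 0, while ln 0 = 0 in R, so
   that 0 log 0 = 0 in both terms. *)
Definition entropy d (T : measurableType d) (R : realType)
    (nu : set T -> \bar R) (g : T -> R) : \bar R :=
  (\int[nu]_x (g x * ln (g x))%:E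
   - (\int[nu]_x (g x)%:E) * lne (\int[nu]_x (g x)%:E))%E.

(* Main.v *)
From HB Require Import structures.
From mathcomp Require Import all_boot all_order all_algebra.
From mathcomp Require Import all_classical all_reals all_analysis.
From mathcomp Require Import measurable_realfun ring lra.
Require Import Defs.

Set Implicit Arguments.
Unset Strict Implicit.
Unset Printing Implicit Defensive.

Import Order.TTheory GRing.Theory Num.Theory.
Import numFieldNormedType.Exports.

Local Open Scope classical_set_scope.
Local Open Scope ring_scope.

(** The generalised Cauchy law is a mixture of Gaussian laws. Write
    a = beta - n/2, let Y have density proportional to exp(-|y|^2) on R^n and
    let t be independent of Y with density proportional to exp(a t - e^t), the
    logarithm of a Gamma(a) variable. Then X = e^(-t/2) Y has law mu_beta: the
    pair (t, X) has density proportional to exp(beta t - omega(x) e^t), and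
    integrating out t leaves omega(x)^(-beta) ([cauchy_measure_mixtureE]). So
    the entropy of f^2 under mu_beta is that of f(e^(-t/2) y)^2 under a product
    law, and entropy tensorizes ([entropy_gap_tensor]): it is enough to have a
    logarithmic Sobolev inequality for each of the two factors.

    - For Y the constant is 1 ([gauss_rV_lsi]), and the y-gradient of
      f(e^(-t/2) y) contributes e^(-t) |grad f(X)|^2.
    - For t there is the weighted inequality
      Ent(u^2) <= (4/a) E[w(t) u'(t)^2], w(t) = ln(a+1) - t + e^t/(a+1)
      ([log_gamma_lsi]). The t-derivative of f(e^(-t/2) y) is
      -(1/2) X.grad f(X), so by Cauchy-Schwarz the contribution is at most
      (1/a) w(t) |X|^2 |grad f(X)|^2.

    It remains to take the conditional expectation of
    w(t) omega(X)/a + e^(-t) given X. There t has density proportional to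
    exp(beta t - omega e^t), whence E[e^t | X] = beta/omega and
    E[e^(-t) | X] = omega/(beta-1), and -t is bounded by a constant plus a
    multiple of e^(-t) through a tangent line of the logarithm. The result is
    at most (2/a) omega (ln omega + (n-2)/a) ([weight_integral_le]), which is
    the claim, as ln sigma = (n-2)/a and 4/(2 beta - n) = 2/a. The hypothesis
    beta <= n - 1 says that (n-2)/a >= 2, and this absorbs the constants.

    Both one-dimensional inequalities come from one statement
    ([probability_lsi_line]): if, in the coordinate Y with Y' = 1/r, the density
    p r is log-concave with constant rho, then Ent(u^2) <= (2/rho) E[r^2 u'^2].
    Its proof transports (u^2 + eps) p onto a multiple of p by an increasing
    map, on bounded intervals where everything is smooth and the boundary terms
    vanish ([transport_antideriv_le]), and then exhausts the line.

    Entropy is handled throughout as the integral of the nonnegative function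
    h ln(h/c) - h + c, with c the mean of h, so that the functional inequalities
    only involve integrals of nonnegative functions; taking h = f^2 + eps keeps
    the logarithm away from 0, and [entropy_le_of_gap] lets eps tend to 0. *)

(** * Measures with a density *)

Section density.
Context d (T : measurableType d) (R : realType).
Variables (m : {measure set T -> \bar R}) (g : T -> R).
Hypotheses (mg : measurable_fun setT g) (g0 : forall x, 0 <= g x).
Local Open Scope ereal_scope.
Import HBNNSimple.

(** Only the values of [n] on sets are assumed, so that the formula applies to
    any measure known to have density [g]. It is checked on simple functions and
    extended by monotone convergence. *)
Lemma ge0_integral_density (n : {measure set T -> \bar R}) (phi : T -> \bar R) :
  (forall A, measurable A -> n A = \int[m]_(x in A) (g x)%:E) ->
  measurable_fun setT phi -> (forall x, 0 <= phi x) ->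
  \int[n]_x phi x = \int[m]_x (phi x * (g x)%:E).
Proof.
move=> nE mphi phi0.
pose h := nnsfun_approx measurableT mphi.
have cvgh x : (h k x)%:E @[k --> \oo] --> phi x by exact: cvg_nnsfun_approx.
have ndh x : {homo (fun k => (h k x)%:E) : a b / (a <= b)%N >-> a <= b}.
  by move=> a b ab; rewrite lee_fin; exact/lefP/nd_nnsfun_approx.
have -> : \int[n]_x phi x = limn (fun k => \int[n]_x (h k x)%:E).
  rewrite -monotone_convergence//.
  - by apply: eq_integral => x _; apply/esym/cvg_lim => //; exact: cvgh.
  - by move=> k; exact/measurable_EFinP.
  - by move=> k x _; rewrite lee_fin.
have -> : \int[m]_x (phi x * (g x)%:E)
    = limn (fun k => \int[m]_x ((h k x)%:E * (g x)%:E)).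
  rewrite -monotone_convergence//.
  - apply: eq_integral => x _; apply/esym/cvg_lim => //.
    by apply: cvgeZr => //; exact: cvgh.
  - by move=> k; apply: emeasurable_funM; exact/measurable_EFinP.
  - by move=> k x _; rewrite mule_ge0 ?lee_fin.
  - by move=> x _ a b ab; rewrite lee_pmul ?lee_fin//; exact: ndh.
congr (limn _); apply/funext => k.
under eq_integral do rewrite fimfunE -fsumEFin//.
rewrite ge0_integral_fsum//; last 2 first.
  - by move=> r; exact/measurable_EFinP/measurableT_comp.
  - by move=> r x _; rewrite EFinM nnfun_muleindic_ge0.
transitivity (\int[m]_x (\sum_(r \in range (h k))
    ((r * \1_(h k @^-1` [set r]) x)%:E * (g x)%:E))); last first.
  apply: eq_integral => x _.
  rewrite -ge0_mule_fsuml; last by move=> r; rewrite nnfun_muleindic_ge0.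
  by rewrite fsumEFin// -fimfunE.
rewrite ge0_integral_fsum//; last 2 first.
  - move=> r; apply: emeasurable_funM; last exact/measurable_EFinP.
    exact/measurable_EFinP/measurableT_comp.
  - move=> r x _; apply: mule_ge0; last by rewrite lee_fin.
    by rewrite EFinM nnfun_muleindic_ge0.
apply: eq_fsbigr => r _.
rewrite integralZl_indic_nnsfun// integral_indic// setIT nE//.
have [r0|r0] := ltP r 0%R.
  rewrite preimage_nnfun0// integral_set0 mule0 integral0_eq// => x _.
  by rewrite indic0 mulr0 mul0e.
under [RHS]eq_integral do rewrite EFinM -muleA.
rewrite ge0_integralZl//; last 2 first.
  - by apply: emeasurable_funM; exact/measurable_EFinP.
  - by move=> x _; rewrite mule_ge0 ?lee_fin.
congr (_ * _); rewrite [LHS]integral_mkcond/=; apply: eq_integral => x _.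
by rewrite /patch indicE; case: ifPn => _; rewrite ?mul1e ?mul0e.
Qed.

Definition density_measure (A : set T) : \bar R := \int[m]_(x in A) (g x)%:E.

Let dens0 : density_measure set0 = 0.
Proof. exact: integral_set0. Qed.

Let dens_ge0 A : 0 <= density_measure A.
Proof. by apply: integral_ge0 => x _; rewrite lee_fin. Qed.

Let dens_sigma : semi_sigma_additive density_measure.
Proof.
move=> F mF tF mUF; rewrite /density_measure ge0_integral_bigcup//; first last.
- by move=> x _; rewrite lee_fin.
- exact/measurable_EFinP/measurable_funTS.
apply: is_cvg_ereal_nneg_natsum_cond => k _ _.
by apply: integral_ge0 => x _; rewrite lee_fin.
Qed.

(** The laws below are used only through the integrals of nonnegative functions
    against them, and this is the property that characterises them. *)
Lemma probability_of_density : \int[m]_x (g x)%:E = 1 ->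
  {P : probability T R | forall phi, measurable_fun setT phi ->
    (forall x, 0 <= phi x) -> \int[P]_x phi x = \int[m]_x (phi x * (g x)%:E)}.
Proof.
move=> g1.
pose M := isMeasure.Build _ _ _ density_measure dens0 dens_ge0 dens_sigma.
pose MM : {measure set T -> \bar R} := HB.pack density_measure M.
have MT : MM setT = 1 by [].
pose P0 := @Measure_isProbability.Build _ _ R MM MT.
pose P : probability T R := HB.pack density_measure M P0.
by exists P => phi mphi phi0; exact: ge0_integral_density.
Qed.

End density.

Section fatou_bound.
Context d (T : measurableType d) (R : realType).
Variable m : {measure set T -> \bar R}.
Local Open Scope ereal_scope.

(** A bound passes to pointwise limits by Fatou's lemma. *)
Lemma integral_le_of_cvg (f : nat -> T -> \bar R) (g : T -> \bar R) (D : \bar R) :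
  (forall n, measurable_fun setT (f n)) -> (forall n x, 0 <= f n x) ->
  (forall x, f n x @[n --> \oo] --> g x) ->
  (forall n, \int[m]_x f n x <= D) -> \int[m]_x g x <= D.
Proof.
move=> mf f0 fg fD.
have -> : \int[m]_x g x = \int[m]_x limn_einf (f^~ x).
  apply: eq_integral => x _; rewrite is_cvg_limn_einfE; last first.
    by apply/cvg_ex; exists (g x).
  by apply/esym/cvg_lim => //; exact: fg.
apply: (le_trans (fatou _ _ _ _)) => //.
rewrite limn_einf_lim; apply: lime_le; first exact: is_cvg_einfs.
near=> n; apply: (le_trans _ (fD n)).
by apply: ereal_inf_lbound; exists n => /=.
Unshelve. all: by end_near. Qed.

End fatou_bound.

(** * Calculus of one real variable *)

Section ln_tangent.
Context {R : realType}.

(** The tangent line of the logarithm at 1: it makes [bregman] nonnegative and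
    gives the explicit bounds on the log-gamma law. *)
Lemma ln_le_subr1 (x : R) : 0 < x -> ln x <= x - 1.
Proof.
by move=> x0; rewrite -[X in ln X](subrK 1) addrC le_ln1Dx// ltrBrDl subrr.
Qed.

End ln_tangent.

Section continuous_pointwise.
Context {R : realType}.
Implicit Types f g : R -> R.

Lemma continuous_mul f g :
  continuous f -> continuous g -> continuous (fun x => f x * g x).
Proof. by move=> cf cg x; apply: continuousM; [exact: cf|exact: cg]. Qed.

Lemma continuous_add f g :
  continuous f -> continuous g -> continuous (fun x => f x + g x).
Proof. by move=> cf cg x; apply: continuousD; [exact: cf|exact: cg]. Qed.

Lemma continuous_sub f g :
  continuous f -> continuous g -> continuous (fun x => f x - g x).
Proof. by move=> cf cg x; apply: continuousB; [exact: cf|exact: cg]. Qed.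

Lemma continuous_sqr f : continuous f -> continuous (fun x => f x ^+ 2).
Proof. by move=> cf; exact: continuous_mul. Qed.

Lemma continuous_inv f : (forall x, 0 < f x) ->
  continuous f -> continuous (fun x => (f x)^-1).
Proof.
by move=> f0 cf x; apply: continuousV; [rewrite gt_eqF|exact: cf].
Qed.

Lemma continuous_log f : (forall x, 0 < f x) ->
  continuous f -> continuous (fun x => ln (f x)).
Proof.
by move=> f0 cf x; apply: continuous_comp; [exact: cf|exact: continuous_ln].
Qed.

Lemma continuous_const (k : R) : continuous (fun _ : R => k).
Proof. by move=> x; exact: cvg_cst. Qed.

End continuous_pointwise.

Section inverse.
Context {R : realType}.

Lemma is_derive_continuous (f : R -> R) (x df : R) :
  is_derive x 1 f df -> {for x, continuous f}.
Proof. by move=> [Df _]; exact/differentiable_continuous/derivable1_diffP. Qed.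

Lemma deriv_lt (f df : R -> R) (a b : R) :
  (forall x, a <= x <= b -> is_derive x 1 f (df x)) ->
  (forall x, a <= x <= b -> 0 < df x) -> a < b -> f a < f b.
Proof.
move=> fd df0 ab; have [| |z] := MVT (f := f) (df := df) ab.
- move=> x xab; apply: fd; move: xab; rewrite in_itv/= => /andP[? ?].
  by rewrite !ltW.
- apply: continuous_in_subspaceT => x; rewrite inE/= in_itv/= => xab.
  exact: is_derive_continuous (fd _ xab).
- move=> zab e; rewrite -subr_gt0 e mulr_gt0 ?subr_gt0// df0//.
  by move: zab; rewrite in_itv/= => /andP[? ?]; rewrite !ltW.
Qed.

Lemma deriv_le (f df : R -> R) (a b : R) :
  (forall x, a <= x <= b -> is_derive x 1 f (df x)) ->
  (forall x, a <= x <= b -> 0 <= df x) -> a <= b -> f a <= f b.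
Proof.
move=> fd df0 ab; have [| |z] := MVT_segment (f := f) (df := df) ab.
- move=> x xab; apply: fd; move: xab; rewrite in_itv/= => /andP[? ?].
  by rewrite !ltW.
- apply: continuous_in_subspaceT => x; rewrite inE/= in_itv/= => xab.
  exact: is_derive_continuous (fd _ xab).
- by rewrite in_itv/= => zab e; rewrite -subr_ge0 e mulr_ge0 ?subr_ge0// df0.
Qed.

(** [G] is controlled on the open interval only, so the inverse is the choice of
    a preimage there; strict monotonicity makes this choice unique. *)
Lemma deriv_inverse (G p : R -> R) (u v : R) :
  (forall x, u < x < v -> is_derive x 1 G (p x)) ->
  (forall x, u < x < v -> 0 < p x) ->
  exists g : R -> R, forall x, u < x < v ->
    g (G x) = x /\ is_derive (G x) 1 g (p x)^-1.
Proof.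
move=> Gd p0.
have Ginj x y : u < x < v -> u < y < v -> G x = G y -> x = y.
  have Glt s t : u < s < v -> u < t < v -> s < t -> G s < G t.
    move=> /andP[us sv] /andP[ut tv] st; apply: (deriv_lt (df := p)) => //.
    - by move=> z /andP[sx xt]; apply: Gd; rewrite (lt_le_trans us)//= (le_lt_trans xt).
    - by move=> z /andP[sx xt]; apply: p0; rewrite (lt_le_trans us)//= (le_lt_trans xt).
  move=> xuv yuv Gxy; have [xy|yx|//] := ltgtP x y.
  - by have := Glt _ _ xuv yuv xy; rewrite Gxy ltxx.
  - by have := Glt _ _ yuv xuv yx; rewrite Gxy ltxx.
(* 0 is the default value off the image of G *)
pose g y := xget 0 [set z | u < z < v /\ G z = y].
have gG x : u < x < v -> g (G x) = x.
  move=> xuv; rewrite /g; case: xgetP => [z _ [zuv Gz]|/(_ x)/=].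
    exact: Ginj.
  by move=> /not_andP[].
exists g => x xuv; split; first exact: gG.
have nuv : \forall z \near x, u < z < v.
  move: xuv => /andP[ux xv]; near=> z; apply/andP; split; near: z.
  - exact: lt_nbhsr.
  - exact: lt_nbhsl.
apply: is_derive_inverse.
- by apply: filterS nuv => z; exact: gG.
- by apply: filterS nuv => z zuv; exact: is_derive_continuous (Gd _ zuv).
- exact: Gd.
- by rewrite gt_eqF// p0.
Unshelve. all: by end_near. Qed.

End inverse.

Section antiderivative.
Context {R : realType}.
Variables (f : R -> R) (a b : R).
Hypotheses (ab : a < b) (cf : continuous f).

(** The margin of 1 on both sides gives two-sided derivatives at [a] and [b]. *)
Lemma antiderivative_exists :
  exists F : R -> R, forall x : R, a - 1 < x < b + 1 -> is_derive x 1 F (f x).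
Proof.
exists (fun y => \int[lebesgue_measure]_(t in `[a - 1, y]) f t) => x /andP[ax xb].
have [||| dF F'] := @continuous_FTC1_closed R f (a - 1) x (b + 1) xb.
- apply: continuous_compact_integrable; first exact: segment_compact.
  exact: continuous_subspaceT.
- by [].
- exact: cf.
by split; [exact: dF|rewrite -derive1E; exact: F'].
Qed.

Lemma integral_itv_antiderivative (F : R -> R) :
  (forall x : R, a - 1 < x < b + 1 -> is_derive x 1 F (f x)) ->
  (\int[lebesgue_measure]_(x in `[a, b]) (f x)%:E = (F b - F a)%:E)%E.
Proof.
move=> Fd; have itvW x : a <= x <= b -> a - 1 < x < b + 1.
  by move=> /andP[ax xb]; apply/andP; split; lra.
rewrite (continuous_FTC2 ab (F := F)) ?EFinB//.
- exact: continuous_subspaceT.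
- have aab : a <= a <= b by rewrite lexx ltW.
  have bab : a <= b <= b by rewrite lexx ltW.
  split.
  + move=> x; rewrite in_itv/= => /andP[ax xb].
    have xab : a <= x <= b by rewrite !ltW.
    by have [] := Fd x (itvW x xab).
  + apply: cvg_at_right_filter; exact: is_derive_continuous (Fd _ (itvW _ aab)).
  + apply: cvg_at_left_filter; exact: is_derive_continuous (Fd _ (itvW _ bab)).
- move=> x; rewrite in_itv/= => /andP[ax xb].
  have xab : a <= x <= b by rewrite !ltW.
  by have [_ <-] := Fd x (itvW x xab); rewrite derive1E.
Qed.

End antiderivative.

Section global_antiderivative.
Context {R : realType}.

Lemma deriv0_eq (f : R -> R) (a b : R) : a <= b ->
  (forall x, a <= x <= b -> is_derive x 1 f 0) -> f a = f b.
Proof.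
move=> ab fd; have [| |z _] := MVT_segment (f := f) (df := fun=> 0) ab.
- by move=> x /subset_itv_oo_cc; rewrite /= in_itv/=; exact: fd.
- apply: continuous_in_subspaceT => x; rewrite inE/= in_itv/= => xab.
  exact: is_derive_continuous (fd _ xab).
- by rewrite mul0r => /eqP; rewrite subr_eq0 => /eqP.
Qed.

(** Antiderivatives on the intervals [-n, n], normalised at 0, agree where they
    are both defined and so can be glued. *)
Lemma continuous_antiderivative (f : R -> R) : continuous f ->
  exists F : R -> R, forall x : R, is_derive x 1 F (f x).
Proof.
move=> cf.
have ex n : {F : R -> R | forall x : R, `|x| < n%:R -> is_derive x 1 F (f x)}.
  apply: cid; have [F Fd] := antiderivative_exists (- n%:R) n%:R cf.
  exists F => x; rewrite ltr_norml => /andP[nx xn]; apply: Fd.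
  by apply/andP; split; lra.
pose G n x := sval (ex n) x - sval (ex n) 0.
have Gd n (x : R) : `|x| < n%:R -> is_derive x 1 (G n) (f x).
  by move=> xn; have := svalP (ex n) x xn => Fd; apply: is_derive_eq; rewrite subr0.
have G0 n : G n 0 = 0 by rewrite /G subrr.
have GE m n x : `|x| < m%:R -> `|x| < n%:R -> G m x = G n x.
  move=> xm xn.
  have D0 (z : R) : `|z| <= `|x| -> is_derive z 1 (fun y => G m y - G n y) 0.
    move=> zx; have Gm := Gd m z (le_lt_trans zx xm).
    have Gn := Gd n z (le_lt_trans zx xn).
    by apply: is_derive_eq; rewrite subrr.
  suff : G m x - G n x = G m 0 - G n 0.
    by rewrite !G0 subrr => /eqP; rewrite subr_eq0 => /eqP.
  have [x0|/ltW x0] := leP 0 x.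
    apply/esym/(@deriv0_eq (fun y => G m y - G n y)) => // z /andP[z0 zx].
    by apply: D0; rewrite !ger0_norm.
  apply: (@deriv0_eq (fun y => G m y - G n y)) => // z /andP[xz z0].
  by apply: D0; rewrite !ler0_norm// lerN2.
exists (fun x => G (Num.truncn `|x|).+1 x) => x.
pose N := (Num.truncn `|x|).+1.
have xN : `|x| < N%:R by rewrite truncnS_gt.
apply: (@near_eq_is_derive _ _ _ (G N)) (Gd N x xN).
near=> z; apply: GE; last by rewrite truncnS_gt.
near: z; apply: (@cvgr_lt _ R _ _ (fun z : R => `|z|) `|x|) => //.
exact: norm_continuous.
Unshelve. all: by end_near. Qed.

End global_antiderivative.

Section symmetric_intervals.
Context {R : realType}.
Let mu := @lebesgue_measure R.

Definition sym_itv (n : nat) : set (measurableTypeR R) :=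
  [set` `[- n.+1%:R, n.+1%:R]%R].

Lemma cvg_integral_sym_itv (f : R -> R) : continuous f -> (forall x, 0 <= f x) ->
  (\int[mu]_(x in sym_itv n) (f x)%:E)%E @[n --> \oo] --> (\int[mu]_x (f x)%:E)%E.
Proof.
move=> cf f0.
have -> : [set: measurableTypeR R] = \bigcup_n sym_itv n.
  apply/esym; rewrite -subTset => x _.
  have [n nx] : exists n, `|x| <= n%:R.
    by exists (Num.truncn `|x|).+1; rewrite ltW// truncnS_gt.
  exists n => //; rewrite /sym_itv /= in_itv/= -ler_norml (le_trans nx)//.
  by rewrite ler_nat.
apply: ge0_nondecreasing_set_cvg_integral.
- move=> i j ij; apply/subsetPset/subset_itv; rewrite bnd_simp ?lerN2 ler_nat ltnS//.
- by move=> i; exact: measurable_itv.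
- move=> i; apply/measurable_EFinP/measurable_funTS.
  exact: continuous_measurable_fun.
- by move=> i x _; rewrite lee_fin.
Qed.

End symmetric_intervals.

(** * Entropy as the integral of a nonnegative function *)

(** The Bregman divergence of x ln x: nonnegative, and with integral the entropy
    of [h] when [c] is its mean. *)
Definition bregman {R : realType} (h c : R) : R := h * ln (h / c) - h + c.

Section bregman.
Context {R : realType}.
Implicit Types h c : R.

Lemma bregman_ge0 h c : 0 < h -> 0 < c -> 0 <= bregman h c.
Proof.
move=> h0 c0; rewrite /bregman.
have ch : 0 < c / h by rewrite divr_gt0.
have /(ler_wpM2l (ltW h0)) := ln_le_subr1 ch.
rewrite mulrBr mulr1 mulrCA divff ?gt_eqF// mulr1 -(invrK (c / h)) invf_div.
by rewrite lnV ?posrE ?divr_gt0//; lra.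
Qed.

(** Lets the mean over growing intervals be replaced by its limit. *)
Lemma cvg_bregman h c (u : nat -> R) : 0 < h -> 0 < c ->
  u @ \oo --> c -> bregman h (u n) @[n --> \oo] --> bregman h c.
Proof.
move=> h0 c0 uc; rewrite /bregman; apply: cvgD => //; apply: cvgB; last exact: cvg_cst.
apply: cvgM; first exact: cvg_cst.
apply: (@continuous_cvg _ _ _ _ _ (fun n => h / u n) (@ln R)).
  by apply: continuous_ln; rewrite divr_gt0.
apply: cvgM; first exact: cvg_cst.
by apply: cvgV => //; rewrite gt_eqF.
Qed.

Lemma measurable_bregman d (T : measurableType d) (f : T -> R) c :
  measurable_fun setT f -> measurable_fun setT (fun x => bregman (f x) c).
Proof.
move=> mf; apply: measurable_funD => //; apply: measurable_funB => //.
apply: measurable_funM => //.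
apply: measurableT_comp; first exact: measurable_ln.
exact: measurable_funM.
Qed.

End bregman.

Section bregman_more.
Context {R : realType}.

Lemma bregmanE (h c : R) : 0 < h -> 0 < c ->
  bregman h c = h * (ln h - ln c) - h + c.
Proof. by move=> h0 c0; rewrite /bregman ln_div. Qed.

Lemma measurable_bregman2 d (T : measurableType d) (f g : T -> R) :
  (forall x, 0 < f x) -> (forall x, 0 < g x) ->
  measurable_fun setT f -> measurable_fun setT g ->
  measurable_fun setT (fun x => bregman (f x) (g x)).
Proof.
move=> f0 g0 mf mg.
under eq_fun do rewrite bregmanE//.
apply: measurable_funD => //; apply: measurable_funB => //.
apply: measurable_funM => //; apply: measurable_funB.
- by apply: measurableT_comp; first exact: measurable_ln.
- by apply: measurableT_comp; first exact: measurable_ln.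
Qed.

(** This is the inequality [bregman h (H * K / c) >= 0] expanded. When [H] and
    [K] are the two partial means of [h] under a product law and [c] its mean,
    [H + K] and [H * K / c + c] both have integral [2 * c], and what is left is
    the tensorization of entropy. *)
Lemma bregman_prod_le (h H K c : R) : 0 < h -> 0 < H -> 0 < K -> 0 < c ->
  bregman h c + (H + K) <= bregman h H + bregman h K + (H * K / c + c).
Proof.
move=> h0 H0 K0 c0.
have b0 : 0 < H * K / c by rewrite divr_gt0 ?mulr_gt0.
have := bregman_ge0 h0 b0; rewrite !bregmanE// ln_div ?posrE ?mulr_gt0//.
rewrite lnM ?posrE//; lra.
Qed.

End bregman_more.

(** The entropy of [h], written so that it is meaningful, possibly infinite, for
    every positive [h] with finite mean. *)
Definition entropy_gap d (T : measurableType d) (R : realType)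
    (P : probability T R) (h : T -> R) : \bar R :=
  (\int[P]_x (bregman (h x) (\int[P]_z h z)%R)%:E)%E.

Lemma probability_integral_cst d (T : measurableType d) (R : realType)
    (P : probability T R) (k : R) : (\int[P]_x k%:E = k%:E)%E.
Proof.
rewrite integral_cst// -[RHS]mule1; congr (_ * _)%E; exact: probability_setT.
Qed.

Section mean.
Context d (T : measurableType d) (R : realType) (P : probability T R).
Variables (h : T -> R) (eps M : R).
Hypotheses (mh : measurable_fun setT h) (eps0 : 0 < eps).
Hypotheses (h_ge : forall x, eps <= h x) (h_le : forall x, h x <= M).

Lemma meanE : (\int[P]_x (h x)%:E = (\int[P]_x h x)%R%:E)%E.
Proof.
have h0 x : 0 <= h x by rewrite (le_trans (ltW eps0)).
rewrite fineK// ge0_fin_numE; last by apply: integral_ge0 => x _; rewrite lee_fin.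
apply: (@le_lt_trans _ _ (\int[P]_x M%:E)%E); last first.
  by rewrite probability_integral_cst ltry.
apply: ge0_le_integral => //; first by move=> x _; rewrite lee_fin.
- exact/measurable_EFinP.
- by move=> x _; rewrite lee_fin.
Qed.

Lemma mean_ge : eps <= \int[P]_x h x.
Proof.
rewrite -lee_fin -meanE.
have -> : eps%:E = (\int[P]_x eps%:E)%E.
  by rewrite probability_integral_cst.
apply: ge0_le_integral => //; first by move=> x _; rewrite lee_fin ltW.
- exact/measurable_EFinP.
- by move=> x _; rewrite lee_fin.
Qed.

Lemma mean_gt0 : 0 < \int[P]_x h x.
Proof. exact: lt_le_trans mean_ge. Qed.

Lemma mean_le : \int[P]_x h x <= M.
Proof.
rewrite -lee_fin -meanE.
have -> : M%:E = (\int[P]_x M%:E)%E.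
  by rewrite probability_integral_cst.
apply: ge0_le_integral => //.
- by move=> x _; rewrite lee_fin (le_trans (ltW eps0)).
- exact/measurable_EFinP.
- by move=> x _; rewrite lee_fin.
Qed.

End mean.

Section square_plus_eps.
Context {R : realType}.

Lemma measurable_sqr_eps d (T : measurableType d) (f : T -> R) (eps : R) :
  measurable_fun setT f -> measurable_fun setT (fun x => f x ^+ 2 + eps).
Proof. by move=> mf; apply: measurable_funD => //; exact: measurable_funX. Qed.

Lemma sqr_eps_le (u M eps : R) : `|u| <= M -> u ^+ 2 + eps <= M ^+ 2 + eps.
Proof.
move=> uM; rewrite lerD2r -real_normK ?num_real// lerXn2r ?nnegrE//.
by rewrite (le_trans _ uM).
Qed.

End square_plus_eps.

Section tensorization.
Context d1 d2 (X : measurableType d1) (Y : measurableType d2) (R : realType).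
Variables (P : probability X R) (Q : probability Y R).
Variables (h : X -> Y -> R) (eps M : R) (A B : X -> Y -> \bar R).
Hypotheses (mh : measurable_fun setT (fun z : X * Y => h z.1 z.2)).
Hypotheses (eps0 : 0 < eps).
Hypotheses (h_ge : forall x y, eps <= h x y) (h_le : forall x y, h x y <= M).
Hypothesis mA : measurable_fun setT (fun z : X * Y => A z.1 z.2).
Hypothesis mB : measurable_fun setT (fun z : X * Y => B z.1 z.2).
Hypotheses (A0 : forall x y, (0 <= A x y)%E) (B0 : forall x y, (0 <= B x y)%E).
Local Open Scope ereal_scope.
Hypothesis PA : forall y, entropy_gap P (h ^~ y) <= \int[P]_x A x y.
Hypothesis QB : forall x, entropy_gap Q (h x) <= \int[Q]_y B x y.

(** Subadditivity of entropy: [bregman_prod_le] with the partial means [H], [K]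
    of [h] bounds the entropy of [h] by the averages of the entropies of its
    slices, to which the hypotheses apply. *)
Lemma entropy_gap_tensor c : \int[P]_x \int[Q]_y (h x y)%:E = c%:E ->
  \int[P]_x \int[Q]_y (bregman (h x y) c)%:E <=
  \int[P]_x \int[Q]_y (A x y + B x y).
Proof.
move=> cE.
have h0 x y : (0 < h x y)%R by rewrite (lt_le_trans eps0).
have mhx x : measurable_fun setT (h x).
  exact: (measurableT_comp mh (pair1_measurable x)).
have mhy y : measurable_fun setT (h ^~ y).
  exact: (measurableT_comp mh (pair2_measurable y)).
pose H y := (\int[P]_x h x y)%R.
pose K x := (\int[Q]_y h x y)%R.
have HE y : \int[P]_x (h x y)%:E = (H y)%:E.
  exact: (@meanE _ _ _ P (h ^~ y) eps M).
have KE x : \int[Q]_y (h x y)%:E = (K x)%:E.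
  exact: (@meanE _ _ _ Q (h x) eps M).
have H0 y : (0 < H y)%R by exact: (@mean_gt0 _ _ _ P (h ^~ y) eps M).
have K0 x : (0 < K x)%R by exact: (@mean_gt0 _ _ _ Q (h x) eps M).
pose hz := fun z : X * Y => (h z.1 z.2)%:E.
have mhz : measurable_fun setT hz by exact/measurable_EFinP.
have hz0 z : 0 <= hz z by rewrite lee_fin ltW.
have mH : measurable_fun setT H.
  apply/measurable_EFinP.
  rewrite (_ : EFin \o H = fubini_G P hz); last first.
    by apply/funext => y; rewrite /fubini_G /hz /= HE.
  exact: measurable_fun_fubini_tonelli_G.
have mK : measurable_fun setT K.
  apply/measurable_EFinP.
  rewrite (_ : EFin \o K = fubini_F Q hz); last first.
    by apply/funext => y; rewrite /fubini_F /hz /= KE.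
  exact: measurable_fun_fubini_tonelli_F.
have c1 : \int[P]_x (K x)%:E = c%:E.
  by rewrite -cE; apply: eq_integral => x _; rewrite KE.
have c2 : \int[Q]_y (H y)%:E = c%:E.
  rewrite -cE (fubini_tonelli _ mhz hz0)/=.
  by apply: eq_integral => x _; rewrite /hz/= HE.
have c0 : (0 < c)%R.
  rewrite -lte_fin -c1; apply: (@lt_le_trans _ _ eps%:E); first by rewrite lte_fin.
  have K_ge x : (eps <= K x)%R by exact: (@mean_ge _ _ _ Q (h x) eps M).
  have K_le x : (K x <= M)%R by exact: (@mean_le _ _ _ Q (h x) eps M).
  by rewrite (@meanE _ _ _ P K eps M)// lee_fin; exact: (@mean_ge _ _ _ P K eps M).
have mfst : measurable_fun setT (fun z : X * Y => K z.1).
  exact: (measurableT_comp mK measurable_fst).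
have msnd : measurable_fun setT (fun z : X * Y => H z.2).
  exact: (measurableT_comp mH measurable_snd).
pose L z := (bregman (h z.1 z.2) c)%:E.
pose LH z := (bregman (h z.1 z.2) (H z.2))%:E.
pose LK z := (bregman (h z.1 z.2) (K z.1))%:E.
have mL : measurable_fun setT L by apply/measurable_EFinP/measurable_bregman.
have mLH : measurable_fun setT LH.
  by apply/measurable_EFinP; apply: measurable_bregman2.
have mLK : measurable_fun setT LK.
  by apply/measurable_EFinP; apply: measurable_bregman2.
have L0 z : 0 <= L z by rewrite lee_fin bregman_ge0.
have LH0 z : 0 <= LH z by rewrite lee_fin bregman_ge0.
have LK0 z : 0 <= LK z by rewrite lee_fin bregman_ge0.
have HK0 z : 0 <= (H z.2 + K z.1)%:E by rewrite lee_fin addr_ge0// ltW.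
have HKc0 z : 0 <= (H z.2 * K z.1 / c + c)%:E.
  by rewrite lee_fin addr_ge0 ?(ltW c0)// divr_ge0 ?(ltW c0)// mulr_ge0// ltW.
have mHK : measurable_fun setT (fun z => (H z.2 + K z.1)%:E).
  by apply/measurable_EFinP; exact: measurable_funD.
have mHKc : measurable_fun setT (fun z => (H z.2 * K z.1 / c + c)%:E).
  apply/measurable_EFinP/measurable_funD => //; apply: measurable_funM => //.
  exact: measurable_funM.
have key : \int[P \x Q]_z (L z + (H z.2 + K z.1)%:E) <=
    \int[P \x Q]_z (LH z + LK z + (H z.2 * K z.1 / c + c)%:E).
  apply: ge0_le_integral => //.
  - by move=> z _; rewrite adde_ge0.
  - exact: emeasurable_funD.
  - by do 2 apply: emeasurable_funD => //.
  - by move=> z _; rewrite -!EFinD lee_fin; exact: bregman_prod_le.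
(* both affine terms have integral 2 c and cancel *)
have IHK : \int[P \x Q]_z (H z.2 + K z.1)%:E = (c + c)%:E.
  rewrite fubini_tonelli1//.
  transitivity (\int[P]_x (c%:E + (K x)%:E)).
    apply: eq_integral => x _; rewrite /fubini_F/=.
    under eq_integral do rewrite EFinD.
    rewrite ge0_integralD//.
    + by rewrite c2 probability_integral_cst.
    + by move=> y _; rewrite lee_fin ltW.
    + exact/measurable_EFinP.
    + by move=> y _; rewrite lee_fin ltW.
  rewrite ge0_integralD//.
  - by rewrite c1 probability_integral_cst.
  - by move=> x _; rewrite lee_fin ltW.
  - by move=> x _; rewrite lee_fin ltW.
  - exact/measurable_EFinP.
have IHKc : \int[P \x Q]_z (H z.2 * K z.1 / c + c)%:E = (c + c)%:E.
  rewrite fubini_tonelli1//.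
  transitivity (\int[P]_x ((K x)%:E + c%:E)).
    apply: eq_integral => x _; rewrite /fubini_F/=.
    transitivity (\int[Q]_y ((K x / c)%:E * (H y)%:E + c%:E)).
      by apply: eq_integral => y _; rewrite -EFinM -EFinD; congr EFin; ring.
    rewrite ge0_integralD//.
    + rewrite probability_integral_cst; congr (_ + _).
      rewrite ge0_integralZl//.
      * by rewrite c2 -EFinM divfK// gt_eqF.
      * exact/measurable_EFinP.
      * by move=> y _; rewrite lee_fin ltW.
      * by rewrite lee_fin divr_ge0// ltW.
    + by move=> y _; rewrite -EFinM lee_fin mulr_ge0// ?divr_ge0// ltW.
    + by apply: measurable_funeM; exact/measurable_EFinP.
    + by move=> y _; rewrite lee_fin ltW.
  rewrite ge0_integralD//.
  - by rewrite c1 probability_integral_cst.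
  - by move=> x _; rewrite lee_fin ltW.
  - exact/measurable_EFinP.
  - by move=> x _; rewrite lee_fin ltW.
have sumLE : \int[P \x Q]_z L z <= \int[P \x Q]_z LH z + \int[P \x Q]_z LK z.
  move: key; rewrite ge0_integralD// IHK ge0_integralD//.
  - by rewrite IHKc leeD2rE// ge0_integralD.
  - by move=> z _; rewrite adde_ge0.
  - exact: emeasurable_funD.
have mAB : measurable_fun setT (fun z : X * Y => A z.1 z.2 + B z.1 z.2).
  exact: emeasurable_funD.
rewrite -[leLHS](fubini_tonelli1 _ mL L0).
rewrite -[leRHS](fubini_tonelli1 _ mAB); last by move=> z; rewrite adde_ge0.
rewrite ge0_integralD//; apply: (le_trans sumLE); apply: leeD.
- rewrite (fubini_tonelli2 _ mLH LH0) (fubini_tonelli2 _ mA)//.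
  apply: ge0_le_integral => //.
  + by move=> y _; apply: integral_ge0 => x _; exact: LH0.
  + exact: measurable_fun_fubini_tonelli_G.
  + by apply: measurable_fun_fubini_tonelli_G => //.
  + by move=> y _; exact: PA.
- rewrite (fubini_tonelli1 _ mLK LK0) (fubini_tonelli1 _ mB)//.
  apply: ge0_le_integral => //.
  + by move=> y _; apply: integral_ge0 => x _; exact: LK0.
  + exact: measurable_fun_fubini_tonelli_F.
  + by apply: measurable_fun_fubini_tonelli_F => //.
  + by move=> y _; exact: QB.
Qed.

End tensorization.

Section entropy_limit.
Context {R : realType}.

(** For small [e] this compares the entropy integrand of a function with that of
    its translate by [e]. *)
Lemma xlnx_superadd (x e : R) : 0 <= x -> 0 < e ->
  x * ln x + e * ln e <= (x + e) * ln (x + e).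
Proof.
move=> x0 e0; have xe : 0 < x + e by rewrite ltr_wpDl.
rewrite mulrDl lerD//; last by rewrite ler_pM2l// ler_ln ?posrE// lerDr.
move: x0; rewrite le_eqVlt => /predU1P[<-|x0]; first by rewrite !mul0r.
by rewrite ler_pM2l// ler_ln ?posrE// lerDl ltW.
Qed.

Lemma xlnx_le_bregman (x c e : R) : 0 <= x -> 0 <= c -> 0 < e ->
  x * ln x <= bregman (x + e) (c + e) + (ln (c + e) + 1) * x +
    (e * ln (c + e) - c - e * ln e).
Proof.
move=> x0 c0 e0; have := xlnx_superadd x0 e0.
rewrite bregmanE ?ltr_wpDl//; lra.
Qed.

(** The rate at which e ln e vanishes at 0, in the variable s with e = s^2. *)
Lemma sqr_ln_ge (s : R) : 0 < s -> - (s ^+ 2 * ln (s ^+ 2)) <= 2 * s.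
Proof.
move=> s0; have is0 : 0 < s^-1 by rewrite invr_gt0.
have := ln_le_subr1 is0; rewrite lnV ?posrE// => /(ler_wpM2l (ltW s0)).
rewrite mulrBr divff ?gt_eqF// mulr1 => h.
rewrite lnXn// mulr2n.
have h2 : s * (s * - ln s) <= s * (1 - s) by rewrite ler_pM2l.
have : 0 <= s * s by rewrite mulr_ge0 ?ltW.
rewrite expr2; lra.
Qed.

(** The limit [e -> 0] in the hypothesis, made quantitative: at [e = s ^+ 2] the
    right-hand side exceeds its limit by at most a multiple of [s]. *)
Lemma xlnx_limit (X d c : R) : 0 <= c ->
  (forall e, 0 < e -> X <= d + (c + e) * ln (c + e) - e * ln e) ->
  X - c * ln c <= d.
Proof.
rewrite le_eqVlt => /predU1P[<- /(_ 1 ltr01)|c0 XP].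
  by rewrite mul0r add0r ln1 !mulr0; lra.
apply/ler_addgt0Pr => e e0.
have ic0 : 0 < c^-1 by rewrite invr_gt0.
pose K := `|ln c| + 3 + c^-1.
have K0 : 0 < K.
  by have := normr_ge0 (ln c); rewrite /K; lra.
(* s <= 1 makes s^2 <= s, and s K <= e leaves room for all error terms *)
pose s := Num.min 1 (e / K).
have s0 : 0 < s by rewrite lt_min ltr01 divr_gt0.
have s1 : s <= 1 by rewrite ge_min lexx.
have sK : s * K <= e by rewrite -ler_pdivlMr// ge_min lexx orbT.
have e20 : 0 < s ^+ 2 by rewrite exprn_gt0.
have e2s : s ^+ 2 <= s by rewrite expr2 ger_pMl.
have := XP _ e20; have := sqr_ln_ge s0.
set E := s ^+ 2 in e20 e2s * => h1 h2.
have lnc : ln (c + E) <= ln c + E / c.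
  have -> : c + E = c * (1 + E / c) by field; rewrite gt_eqF.
  have Ec0 : 0 < E / c by rewrite divr_gt0.
  have Ec1 : 0 < 1 + E / c by rewrite addr_gt0.
  by rewrite lnM ?posrE// lerD2l le_ln1Dx// (lt_trans (ltrN10 _)).
have h3 : (c + E) * ln (c + E) <= c * ln c + E * (`|ln c| + 1 + c^-1).
  apply: (le_trans (ler_wpM2l (ltW (addr_gt0 c0 e20)) lnc)).
  have -> : (c + E) * (ln c + E / c) = c * ln c + E * (ln c + 1 + E / c).
    by field; rewrite gt_eqF.
  rewrite lerD2l ler_pM2l//; apply: lerD; first by rewrite lerD2r ler_norm.
  by rewrite ler_piMl ?(ltW ic0)// (le_trans e2s).
have h4 : E * (`|ln c| + 1 + c^-1) <= s * (`|ln c| + 1 + c^-1).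
  by rewrite ler_wpM2r// addr_ge0 ?(ltW ic0)// addr_ge0.
move: sK; rewrite /K; lra.
Qed.

(** Adding [e > 0] keeps [g] away from 0, where the logarithm is singular; the
    entropy of [g] is recovered as [e] tends to 0. *)
Lemma entropy_le_of_gap d (T : measurableType d) (P : probability T R)
    (g : T -> R) (M : R) (D : \bar R) :
  measurable_fun setT g -> (forall x, 0 <= g x) -> (forall x, g x <= M) ->
  (forall e, 0 < e -> (entropy_gap P (fun x => g x + e)%R <= D)%E) ->
  (entropy P g <= D)%E.
Proof.
move=> mg g0 gM gapD.
have [x0|no] := pselect (exists x : T, True); last first.
  have := probability_setT P.
  rewrite (_ : [set: T] = set0) ?measure0.
    by move=> /eqP; rewrite eq_sym onee_eq0.
  by apply/seteqP; split => // x _; apply: no; exists x.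
have M0 : 0 <= M by have [x _] := x0; rewrite (le_trans (g0 x)).
have PT : (P setT < +oo)%E by rewrite probability_setT ltry.
have ig : P.-integrable setT (EFin \o g).
  apply: measurable_bounded_integrable => //.
  exists M; split; first exact: num_real.
  by move=> K MK x _ /=; rewrite ger0_norm// (le_trans (gM x))// ltW.
have mgl : measurable_fun setT (fun x => g x * ln (g x)).
  by apply: measurable_funM => //; apply: measurableT_comp.
have igl : P.-integrable setT (EFin \o (fun x => g x * ln (g x))).
  apply: measurable_bounded_integrable => //.
  (* x ln x lies between -1 and x^2 *)
  exists (1 + M ^+ 2); split; first exact: num_real.
  move=> K MK x _ /=; apply: (le_trans _ (ltW MK)).
  have [/eqP gx0|gx0] := boolP (g x == 0).
    by rewrite gx0 mul0r normr0 addr_ge0// sqr_ge0.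
  have gxp : 0 < g x by rewrite lt_neqAle eq_sym gx0 g0.
  have lnu : ln (g x) <= g x by exact/ltW/ln_sublinear.
  have lnl : - ln (g x) <= (g x)^-1.
    by rewrite -lnV ?posrE//; apply/ltW/ln_sublinear; rewrite invr_gt0.
  have h1 : g x * ln (g x) <= M ^+ 2.
    apply: (le_trans (ler_wpM2l (g0 x) lnu)).
    by rewrite -expr2 lerXn2r ?nnegrE.
  have h2 : - (g x * ln (g x)) <= 1.
    rewrite -mulrN; apply: (le_trans (ler_wpM2l (g0 x) lnl)).
    by rewrite divff.
  have M2 : 0 <= M ^+ 2 by rewrite sqr_ge0.
  by rewrite ler_norml; apply/andP; split; lra.
pose c := (\int[P]_x g x)%R.
have cE : (\int[P]_x (g x)%:E = c%:E)%E.
  by rewrite fineK//; exact: integrable_fin_num.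
have c0 : 0 <= c by rewrite fine_ge0// integral_ge0// => x _; rewrite lee_fin.
pose X := (\int[P]_x (g x * ln (g x)))%R.
have XE : (\int[P]_x (g x * ln (g x))%:E = X%:E)%E.
  by rewrite fineK//; exact: integrable_fin_num.
have -> : entropy P g = (X - c * ln c)%:E.
  rewrite /entropy XE cE EFinB; congr (_ - _)%E.
  have [->|cn0] := eqVneq c 0; first by rewrite mul0e mul0r.
  by rewrite lne_EFin ?lt_neqAle 1?eq_sym ?cn0// EFinM.
have mean_eps e : (\int[P]_x (g x + e))%R = c + e.
  have ie : P.-integrable setT (EFin \o (fun=> e : R)).
    exact: finite_measure_integrable_cst.
  rewrite /Rintegral; under eq_integral do rewrite EFinD.
  by rewrite integralD// probability_integral_cst cE.
have gap0 e : 0 < e -> (0 <= entropy_gap P (fun x => g x + e)%R)%E.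
  move=> e0; rewrite /entropy_gap mean_eps; apply: integral_ge0 => x _.
  by rewrite lee_fin bregman_ge0// ltr_wpDl.
case: D gapD => [r| |] gapD; last 2 first.
- exact: leey.
- by have := le_trans (gap0 1 ltr01) (gapD 1 ltr01).
rewrite lee_fin; apply: xlnx_limit => // e e0.
have mean_e : (\int[P]_x (g x + e))%R = c + e := mean_eps e.
have := gapD e e0; rewrite /entropy_gap mean_e => Ue.
pose b x := bregman (g x + e) (c + e).
have ce0 : 0 < c + e by rewrite ltr_wpDl.
have b0 x : 0 <= b x by rewrite bregman_ge0// ltr_wpDl.
have mb : measurable_fun setT b.
  by apply: measurable_bregman; exact: measurable_funD.
have ib : P.-integrable setT (EFin \o b).
  apply/integrableP; split; first exact/measurable_EFinP.
  apply: (@le_lt_trans _ _ r%:E); last exact: ltry.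
  apply: le_trans Ue; rewrite le_eqVlt; apply/orP; left; apply/eqP.
  by apply: eq_integral => x _; rewrite /= ger0_norm.
pose k1 := ln (c + e) + 1.
pose k2 := e * ln (c + e) - c - e * ln e.
have i1 : P.-integrable setT (EFin \o (fun x => k1 * g x)).
  exact: (@integrableZl _ _ _ P _ measurableT k1 (EFin \o g) ig).
have i2 : P.-integrable setT (EFin \o (fun=> k2)) by exact: finite_measure_integrable_cst.
suff : (X%:E <= r%:E + (k1 * c)%:E + k2%:E)%E.
  by rewrite -!EFinD lee_fin /k1 /k2; lra.
rewrite -XE; apply: (@le_trans _ _ (\int[P]_x ((b x)%:E + (k1 * g x)%:E + k2%:E))%E).
  apply: le_integral => //.
  - by apply: integrableD => //; exact: integrableD.
  - by move=> x _; rewrite -!EFinD lee_fin; exact: xlnx_le_bregman.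
rewrite integralD//; last exact: integrableD.
rewrite integralD// probability_integral_cst leeD2r// leeD//.
rewrite (@integralZl _ _ _ _ _ measurableT (EFin \o g) ig k1) cE EFinM.
by [].
Qed.

End entropy_limit.

(** * Weighted log-Sobolev inequalities on the line *)

Section transport.
Context {R : realType}.
Variables (a b rho c : R) (p r Y Q h dh G F E : R -> R).
Hypotheses (ab : a < b) (rho0 : 0 < rho).
Hypotheses (p0 : forall x, 0 < p x) (r0 : forall x, 0 < r x).
Hypotheses (h0 : forall x, 0 < h x).
Hypothesis Yd : forall x : R, is_derive x 1 Y (r x)^-1.
Hypothesis Pd : forall x : R, is_derive x 1 (fun y : R => p y * r y) (- (Q x * p x)).
Hypothesis hd : forall x : R, is_derive x 1 h (dh x).
Hypothesis conv : forall x t, ln (p t * r t) <=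
  ln (p x * r x) - Q x * (Y t - Y x) - rho / 2 * (Y t - Y x) ^+ 2.
Hypothesis Gd : forall x : R, a - 1 < x < b + 1 -> is_derive x 1 G (p x).
Hypothesis Fd : forall x : R, a - 1 < x < b + 1 -> is_derive x 1 F (h x * p x).
Hypothesis Ed : forall x : R, a - 1 < x < b + 1 -> is_derive x 1 E
  (h x * ln (h x / c) * p x - r x ^+ 2 * dh x ^+ 2 / (2 * rho * h x) * p x).
Hypothesis cE : c * (G b - G a) = F b - F a.

(** The heart of the one-dimensional inequality. Here [G], [F] are
    antiderivatives of [p] and [h p], [c] is the mean of [h] over [[a, b]] and
    the conclusion says that the integral of
    h ln(h/c) p - r^2 h'^2 / (2 rho h) p over [[a, b]] is nonpositive.
    Let [T] be the increasing map of [[a, b]] onto itself that carries h p / c to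
    p, and th = Y(T) - Y its displacement in the coordinate [Y]. The equation
    T' p(T) = h p / c reads h/c = (p r)(T) / (p r) * (1 + r th'), so the
    convexity [conv] together with ln(1 + z) <= z gives
    ln(h/c) <= r th' - Q th - (rho/2) th^2.
    Multiplied by h p, the right-hand side is the derivative of
    Phi = th h p r, minus th h' p r, minus (rho/2) th^2 h p; completing the square
    bounds the last two terms by r^2 h'^2 / (2 rho h) p. As [T] fixes the
    endpoints, Phi vanishes at both of them. *)
Lemma transport_antideriv_le : E b <= E a.
Proof.
have itvW x : a <= x <= b -> a - 1 < x < b + 1.
  by move=> /andP[ax xb]; apply/andP; split; lra.
have Gab : G a < G b.
  by apply: (deriv_lt (df := p)) => // x /itvW; exact: Gd.
have Fab : F a < F b.
  apply: (deriv_lt (df := fun z => h z * p z)) => // x.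
    by move=> /itvW; exact: Fd.
  by move=> _; rewrite /= mulr_gt0.
have c0 : 0 < c by rewrite -(pmulr_lgt0 c (_ : 0 < G b - G a)) ?cE subr_gt0.
have [g gP] := deriv_inverse Gd (fun x _ => p0 x).
pose v x := G a + (F x - F a) / c.
pose T x := g (v x).
have TP x : a <= x <= b -> a <= T x <= b /\ G (T x) = v x.
  move=> xab; have /andP[ax xb] := xab.
  have [z zab Gz] : exists2 z, z \in `[a, b] & G z = v x.
    apply: IVT; first exact: ltW.
      apply: continuous_in_subspaceT => z; rewrite inE/= in_itv/= => /itvW zab.
      exact: is_derive_continuous (Gd zab).
    rewrite min_l ?max_r ?(ltW Gab)//; apply/andP; split.
      rewrite lerDl divr_ge0 ?(ltW c0)// subr_ge0.
      apply: (deriv_le (df := fun z => h z * p z)) => //.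
      - by move=> t /andP[at_ tx]; apply/Fd/itvW; rewrite at_ (le_trans tx).
      - by move=> t _; rewrite /= mulr_ge0 ?ltW.
    rewrite -lerBrDl ler_pdivrMr// mulrC cE lerB//.
    apply: (deriv_le (df := fun z => h z * p z)) => //.
    - by move=> t /andP[xt tb]; apply/Fd/itvW; rewrite tb (le_trans ax).
    - by move=> t _; rewrite /= mulr_ge0 ?ltW.
  have [gz _] := gP z (itvW z zab).
  have -> : T x = z by rewrite /T -Gz.
  by split.
have Td x : a <= x <= b -> is_derive x 1 T ((p (T x))^-1 * (h x * p x / c)).
  move=> xab; have [/itvW Tab GT] := TP x xab.
  have [_ gd] := gP _ Tab.
  rewrite GT in gd; have Fdx := Fd (itvW x xab).
  apply: (is_derive1_comp (g := v)).
  rewrite /v; apply: is_derive_eq.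
  by rewrite /GRing.scale/=; field; rewrite gt_eqF.
have Ta : T a = a.
  have aab : a <= a <= b by rewrite lexx ltW.
  have [gGa _] := gP a (itvW _ aab).
  by rewrite -[RHS]gGa /T /v subrr mul0r addr0.
have Tb : T b = b.
  have bab : a <= b <= b by rewrite lexx ltW.
  have [gGb _] := gP b (itvW _ bab).
  rewrite -[RHS]gGb /T /v -cE; congr g.
  by field; rewrite gt_eqF.
pose th x := Y (T x) - Y x.
pose Phi x := th x * (h x * (p x * r x)).
pose dth x := (r (T x))^-1 * ((p (T x))^-1 * (h x * p x / c)) - (r x)^-1.
pose dPhi x := dth x * (h x * (p x * r x)) +
  th x * (dh x * (p x * r x) - h x * (Q x * p x)).
have thd x : a <= x <= b -> is_derive x 1 th (dth x).
  move=> xab; have Tdx := Td x xab.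
  by rewrite /th; apply: is_derive_eq.
have Phid x : a <= x <= b -> is_derive x 1 Phi (dPhi x).
  move=> xab; have thdx := thd x xab.
  rewrite /Phi; apply: is_derive_eq.
  by rewrite /GRing.scale/= /dPhi; ring.
(* Phi - E is shown to be nondecreasing, and Phi vanishes at both ends *)
suff : (Phi \- E) a <= (Phi \- E) b.
  by rewrite /= /Phi /th Ta Tb !subrr !mul0r !sub0r lerN2.
pose dE x := h x * ln (h x / c) * p x -
  r x ^+ 2 * dh x ^+ 2 / (2 * rho * h x) * p x.
apply: (deriv_le (df := fun x => dPhi x - dE x)) => [x xab|x xab|]; last exact: ltW.
  have Phidx := Phid x xab; have Edx := Ed (itvW x xab).
  exact: is_derive_eq.
rewrite subr_ge0 /dPhi /dE.
have hp0 : 0 < h x * p x by rewrite mulr_gt0.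
have lnh : ln (h x / c) <=
    r x * dth x - Q x * th x - rho / 2 * th x ^+ 2.
  have prT : 0 < p (T x) * r (T x) by rewrite mulr_gt0.
  have prx : 0 < p x * r x by rewrite mulr_gt0.
  have -> : h x / c = p (T x) * r (T x) / (p x * r x) * (1 + r x * dth x).
    by rewrite /dth; field; rewrite !gt_eqF.
  have q0 : 0 < 1 + r x * dth x.
    rewrite /dth mulrBr divff ?gt_eqF// addrC subrK.
    by rewrite !mulr_gt0 ?invr_gt0.
  rewrite lnM ?posrE ?divr_gt0// ln_div ?posrE//.
  have dth1 := ln_le_subr1 q0.
  have := conv x (T x); rewrite /th; lra.
have pr0 := mulr_gt0 (p0 x) (r0 x).
have hh : h x * p x * ln (h x / c) <=
    h x * p x * (r x * dth x - Q x * th x - rho / 2 * th x ^+ 2).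
  by rewrite ler_pM2l.
(* the square that absorbs the term th h' p r *)
have sq : 0 <= p x / (2 * rho * h x) * (rho * th x * h x + r x * dh x) ^+ 2.
  by rewrite mulr_ge0 ?sqr_ge0// divr_ge0 ?ltW// !mulr_gt0.
have sqE : p x / (2 * rho * h x) * (rho * th x * h x + r x * dh x) ^+ 2 =
    rho / 2 * th x ^+ 2 * h x * p x + th x * dh x * p x * r x +
    r x ^+ 2 * dh x ^+ 2 / (2 * rho * h x) * p x.
  by field; rewrite !gt_eqF.
rewrite sqE in sq; move: hh sq.
set X := r x ^+ 2 * _ / _ * _; lra.
Qed.
End transport.

Section convexity.
Context {R : realType}.
Variables (rho : R) (p r Y Q dQ : R -> R).
Hypotheses (p0 : forall x, 0 < p x) (r0 : forall x, 0 < r x).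
Hypothesis Yd : forall x : R, is_derive x 1 Y (r x)^-1.
Hypothesis Pd : forall x : R,
  is_derive x 1 (fun y : R => p y * r y) (- (Q x * p x)).
Hypothesis Qd : forall x : R, is_derive x 1 Q (dQ x).
Hypothesis dQ_ge : forall x, rho <= r x * dQ x.

(** The hypothesis [dQ_ge] says that ln(p r), as a function of the coordinate
    [Y], has derivative [- Q] and second derivative at most [- rho]; this is the
    resulting second-order bound. *)
Lemma transport_convexity x t : ln (p t * r t) <=
  ln (p x * r x) - Q x * (Y t - Y x) - rho / 2 * (Y t - Y x) ^+ 2.
Proof.
pose g t := ln (p t * r t) + Q x * (Y t - Y x) + rho / 2 * (Y t - Y x) ^+ 2.
pose dg t := (- Q t + Q x + rho * (Y t - Y x)) / r t.
have gd (z : R) : is_derive z 1 g (dg z).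
  have prz : 0 < p z * r z by rewrite mulr_gt0.
  have lnd := is_derive1_ln prz.
  have Pz := Pd z; have Yz := Yd z.
  have lnP : is_derive z 1 (fun y => ln (p y * r y)) ((p z * r z)^-1 * - (Q z * p z)).
    exact: (@is_derive1_comp _ (@ln R) (fun y => p y * r y)).
  rewrite /g; apply: is_derive_eq.
  by rewrite /GRing.scale/= /dg; field; rewrite !gt_eqF.
have Kd (z : R) : is_derive z 1 (fun y => Q y - rho * Y y) (dQ z - rho * (r z)^-1).
  have Yz := Yd z; have Qz := Qd z; apply: is_derive_eq.
  by rewrite /GRing.scale/=; ring.
have K_le y z : y <= z -> Q y - rho * Y y <= Q z - rho * Y z.
  apply: (deriv_le (f := fun y => Q y - rho * Y y)
    (df := fun z => dQ z - rho * (r z)^-1)) => u _.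
  by rewrite subr_ge0 ler_pdivrMr// mulrC.
suff : g t <= g x by rewrite /g subrr; lra.
have [tx|xt] := leP t x.
- apply: (deriv_le (df := dg)) => // z /andP[tz zx].
  by rewrite /dg divr_ge0 ?(ltW (r0 _))//; have := K_le _ _ zx; lra.
- rewrite -lerN2; apply: (deriv_le (f := fun z => - g z) (df := fun z => - dg z)).
  + move=> z /andP[xz zt]; rewrite -mulNr divr_ge0 ?(ltW (r0 _))//.
    by have := K_le _ _ xz; lra.
  + exact: ltW.
Qed.

End convexity.

Section weighted_lsi.
Context {R : realType}.
Variables (rho : R) (p r Y Q : R -> R).
Hypothesis (rho0 : 0 < rho).
Hypotheses (p0 : forall x, 0 < p x) (r0 : forall x, 0 < r x).
Hypotheses (cp : continuous p) (cr : continuous r).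
Hypothesis Yd : forall x : R, is_derive x 1 Y (r x)^-1.
Hypothesis Pd : forall x : R,
  is_derive x 1 (fun y : R => p y * r y) (- (Q x * p x)).
Hypothesis conv : forall x t, ln (p t * r t) <=
  ln (p x * r x) - Q x * (Y t - Y x) - rho / 2 * (Y t - Y x) ^+ 2.
Let mu := @lebesgue_measure R.

(** [transport_antideriv_le] in terms of integrals; the terms [- h + c] of
    [bregman] have integral 0 against [p] because [c = B / A] is the mean. *)
Lemma lsi_itv (a b A B : R) (h dh : R -> R) : a < b ->
  (forall x, 0 < h x) -> (forall x : R, is_derive x 1 h (dh x)) ->
  continuous dh ->
  (\int[mu]_(x in `[a, b]) (p x)%:E = A%:E)%E ->
  (\int[mu]_(x in `[a, b]) (h x * p x)%:E = B%:E)%E ->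
  (\int[mu]_(x in `[a, b]) (bregman (h x) (B / A) * p x)%:E <=
   \int[mu]_(x in `[a, b])
     (r x ^+ 2 * dh x ^+ 2 / (2 * rho * h x) * p x)%:E)%E.
Proof.
move=> ab h0 hd cdh.
have ch : continuous h by move=> x; exact: is_derive_continuous (hd x).
pose K x := r x ^+ 2 * dh x ^+ 2 / (2 * rho * h x) * p x.
have cK : continuous K.
  apply/continuous_mul => //; apply: continuous_mul.
    by apply: continuous_mul; exact: continuous_sqr.
  apply: continuous_inv => [x|]; first by rewrite !mulr_gt0.
  by apply: continuous_mul => //; exact: continuous_const.
have chp : continuous (fun x => h x * p x).
  exact: continuous_mul.
have [G Gd] := antiderivative_exists a b cp.
have [F Fd] := antiderivative_exists a b chp.
have [K' Kd] := antiderivative_exists a b cK.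
rewrite (integral_itv_antiderivative ab cp Gd) => -[/esym AE].
rewrite (integral_itv_antiderivative ab chp Fd) => -[/esym BE].
have itvW x : a <= x <= b -> a - 1 < x < b + 1.
  by move=> /andP[ax xb]; apply/andP; split; lra.
have A0 : 0 < A.
  rewrite AE subr_gt0; apply: (deriv_lt (df := p)) => // x xab.
  exact: Gd (itvW x xab).
have B0 : 0 < B.
  rewrite BE subr_gt0; apply: (deriv_lt (df := fun x => h x * p x)) => // x xab.
    exact: Fd (itvW x xab).
  exact: mulr_gt0.
set c := B / A.
have c0 : 0 < c by rewrite divr_gt0.
have chln : continuous (fun x => ln (h x / c)).
  apply: continuous_log => [x|]; first by rewrite divr_gt0.
  by apply: continuous_mul => //; exact: continuous_const.
have cE : continuous (fun x => h x * ln (h x / c) * p x - K x).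
  by apply: continuous_sub => //; do 2 apply: continuous_mul => //.
have [E Ed] := antiderivative_exists a b cE.
have Eba : E b <= E a.
  apply: (@transport_antideriv_le _ a b rho c p r Y Q h dh G F) => //.
  by rewrite -AE -BE /c divfK// gt_eqF.
rewrite (integral_itv_antiderivative ab cK Kd).
pose S x := E x + K' x - F x + c * G x.
have -> : (\int[mu]_(x in `[a, b]) (bregman (h x) c * p x)%:E =
    (S b - S a)%:E)%E; last first.
  rewrite lee_fin /S.
  have : c * (G b - G a) = F b - F a by rewrite -AE -BE /c divfK// gt_eqF.
  rewrite mulrBr; lra.
apply: integral_itv_antiderivative => //.
- apply: continuous_mul => //; apply: continuous_add; last exact: continuous_const.
  by apply: continuous_sub => //; exact: continuous_mul.
- move=> x xab; have Ex := Ed x xab; have Kx := Kd x xab.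
  have Fx := Fd x xab; have Gx := Gd x xab.
  rewrite /S; apply: is_derive_eq; rewrite /bregman /GRing.scale/= -/c; ring.
Qed.

Hypothesis p1 : (\int[mu]_x (p x)%:E = 1)%E.

(** Exhaustion of the line by symmetric intervals: the means over them converge
    to [c], so Fatou's lemma applies to the left-hand side, while the
    right-hand side is monotone. *)
Lemma lsi_line (M eps c : R) (u du : R -> R) : 0 < eps ->
  (forall x, `|u x| <= M) -> (forall x : R, is_derive x 1 u (du x)) ->
  continuous du ->
  (\int[mu]_x ((u x ^+ 2 + eps) * p x)%:E = c%:E)%E ->
  (\int[mu]_x (bregman (u x ^+ 2 + eps) c * p x)%:E <=
   (2 / rho)%:E * \int[mu]_x (r x ^+ 2 * du x ^+ 2 * p x)%:E)%E.
Proof.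
move=> eps0 uM ud cdu cE.
pose h x := u x ^+ 2 + eps.
have h0 x : 0 < h x by rewrite ltr_wpDl// sqr_ge0.
have cu : continuous u by move=> x; exact: is_derive_continuous (ud x).
have ch : continuous h.
  by apply: continuous_add; [exact: continuous_sqr|exact: continuous_const].
have chp : continuous (fun x => h x * p x) by exact: continuous_mul.
have cI (f : R -> R) n : continuous f -> (forall x, 0 <= f x) ->
    {y | (\int[mu]_(x in sym_itv n) (f x)%:E = y%:E)%E}.
  move=> cf f0; exists (fine (\int[mu]_(x in sym_itv n) (f x)%:E)%E).
  rewrite fineK//; apply: integrable_fin_num => //; first exact: measurable_itv.
  apply: continuous_compact_integrable; first exact: segment_compact.
  exact: continuous_subspaceT.
have p0' x := ltW (p0 x).
have hp0 x : 0 <= h x * p x by rewrite mulr_ge0// ltW.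
pose A n := sval (cI p n cp p0').
pose B n := sval (cI (fun x => h x * p x) n chp hp0).
have AE n : (\int[mu]_(x in sym_itv n) (p x)%:E = (A n)%:E)%E.
  exact: svalP (cI p n cp p0').
have BE n : (\int[mu]_(x in sym_itv n) (h x * p x)%:E = (B n)%:E)%E.
  exact: svalP (cI _ n chp hp0).
have A1 : A @ \oo --> (1 : R).
  have := cvg_integral_sym_itv cp p0'; rewrite p1 -[1%E]/(1%R%:E) => /fine_cvgP[_].
  by under eq_fun do rewrite AE.
have Bc : B @ \oo --> c.
  have := cvg_integral_sym_itv chp hp0; rewrite cE => /fine_cvgP[_].
  by under eq_fun do rewrite BE.
have nn n : - n.+1%:R < n.+1%:R :> R by rewrite gtrN.
have int_gt0 (f : R -> R) n y : continuous f -> (forall x, 0 < f x) ->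
    (\int[mu]_(x in sym_itv n) (f x)%:E = y%:E)%E -> 0 < y.
  move=> cf f0; have [F Fd] := antiderivative_exists (- n.+1%:R) n.+1%:R cf.
  rewrite (integral_itv_antiderivative (nn n) cf Fd) => -[<-].
  rewrite subr_gt0; apply: (deriv_lt (df := f)) => // x /andP[nx xn].
  by apply: Fd; apply/andP; split; lra.
have A0 n : 0 < A n by exact: int_gt0 (AE n).
have B0 n : 0 < B n by apply: int_gt0 (BE n) => // x; rewrite mulr_gt0.
have c0 : 0 < c.
  rewrite -lte_fin -cE; apply: (@lt_le_trans _ _ (B 0)%:E); first by rewrite lte_fin.
  rewrite -BE; apply: ge0_subset_integral => //; first exact: measurable_itv.
    by apply/measurable_EFinP; exact: continuous_measurable_fun chp.
  by move=> x _; rewrite lee_fin hp0.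
pose D := ((2 / rho)%:E * \int[mu]_x (r x ^+ 2 * du x ^+ 2 * p x)%:E)%E.
pose f n : R -> \bar R :=
  (fun x => (bregman (h x) (B n / A n) * p x)%:E) \_ (sym_itv n).
apply: (@integral_le_of_cvg _ (measurableTypeR R) R mu f).
- move=> n; apply/(measurable_restrictT _ _).1 => //; first exact: measurable_itv.
  apply/measurable_EFinP/measurable_funTS/measurable_funM.
    by apply: measurable_bregman; exact: continuous_measurable_fun.
  exact: continuous_measurable_fun.
- move=> n x; apply: erestrict_ge0 => y _.
  by rewrite lee_fin mulr_ge0// bregman_ge0// divr_gt0.
- move=> x; have [N xN] : exists n, sym_itv n x.
    exists (Num.truncn `|x|); rewrite /sym_itv /= in_itv/= -ler_norml.
    by rewrite ltW// truncnS_gt.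
  have : (bregman (h x) (B n / A n) * p x)%:E @[n --> \oo] -->
      (bregman (h x) c * p x)%:E.
    apply: cvg_EFin; first exact: nearW.
    apply: cvgMl; apply: cvg_bregman => //.
    rewrite -[X in _ --> X]divr1; apply: cvgM => //.
    by apply: cvgV => //; exact: oner_neq0.
  apply: cvg_trans; apply: near_eq_cvg; near=> n; rewrite /f patchE mem_set//.
  move: xN; rewrite /sym_itv /= !in_itv/= -!ler_norml => /le_trans; apply.
  by rewrite ler_nat ltnS; near: n; exact: nbhs_infty_ge.
- move=> n; rewrite /f -integral_mkcond.
  have hd (x : R) : is_derive x 1 h (2 * u x * du x).
    have := ud x => udx; rewrite /h; apply: is_derive_eq.
    by rewrite /GRing.scale/=; ring.
  have cdh : continuous (fun x => 2 * u x * du x).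
    apply: continuous_mul => //; apply: continuous_mul => //.
    exact: continuous_const.
  apply: (le_trans (lsi_itv (nn n) h0 hd cdh (AE n) (BE n))).
  have cRR : continuous (fun x => r x ^+ 2 * du x ^+ 2 * p x).
    apply: continuous_mul => //.
    by apply: continuous_mul; exact: continuous_sqr.
  have mR : measurable_fun setT (fun x => (r x ^+ 2 * du x ^+ 2 * p x)%:E).
    apply/measurable_EFinP; apply: continuous_measurable_fun.
    exact: cRR.
  have R0 x : 0 <= r x ^+ 2 * du x ^+ 2 * p x.
    by rewrite mulr_ge0// mulr_ge0 ?sqr_ge0.
  have cK : continuous (fun x =>
      r x ^+ 2 * (2 * u x * du x) ^+ 2 / (2 * rho * h x) * p x).
    apply: continuous_mul => //; apply: continuous_mul.
      by apply: continuous_mul; exact: continuous_sqr.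
    apply: continuous_inv => [x|]; first by rewrite !mulr_gt0.
    by apply: continuous_mul => //; exact: continuous_const.
  have rho2 : 0 <= 2 / rho by rewrite divr_ge0 ?ltW.
  apply: (@le_trans _ _
    (\int[mu]_(x in sym_itv n) ((2 / rho)%:E * (r x ^+ 2 * du x ^+ 2 * p x)%:E))%E).
    apply: ge0_le_integral => //.
    - move=> x _; rewrite lee_fin mulr_ge0// divr_ge0//.
        by rewrite mulr_ge0 ?sqr_ge0.
      by rewrite ltW// !mulr_gt0.
    - apply/measurable_EFinP/measurable_funTS.
      apply: continuous_measurable_fun; exact: cK.
    - by apply/measurable_funTS/measurable_funeM.
    - move=> x _; rewrite -EFinM lee_fin.
      have -> : r x ^+ 2 * (2 * u x * du x) ^+ 2 / (2 * rho * h x) * p x =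
          2 / rho * (r x ^+ 2 * du x ^+ 2 * p x) * (u x ^+ 2 / h x).
        by field; rewrite !gt_eqF.
      (* h' ^2 / h = 4 u^2 u'^2 / h, and u^2 <= h *)
      rewrite ler_piMr//; first exact: mulr_ge0.
      by rewrite ler_pdivrMr// mul1r lerDl ltW.
  rewrite /D ge0_integralZl//.
  - rewrite lee_wpmul2l ?lee_fin//; apply: ge0_subset_integral.
    + exact: measurable_itv.
    + by [].
    + exact: mR.
    + by move=> x _; rewrite lee_fin; exact: R0.
    + by [].
  - exact: measurable_itv.
  - exact: measurable_funTS.
  - by move=> x _; rewrite lee_fin; exact: R0.
Unshelve. all: by end_near. Qed.

Variable P : probability (measurableTypeR R) R.
Hypothesis PE : forall phi : R -> \bar R,
  measurable_fun [set: measurableTypeR R] phi -> (forall x, 0 <= phi x)%E ->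
  (\int[P]_x phi x = \int[mu]_x (phi x * (p x)%:E))%E.

Lemma probability_lsi_line (M eps : R) (u du : R -> R) :
  0 < eps -> (forall x, `|u x| <= M) ->
  (forall x : R, is_derive x 1 u (du x)) -> continuous du ->
  (entropy_gap P (fun x => u x ^+ 2 + eps)%R <=
   (2 / rho)%:E * \int[P]_x (r x ^+ 2 * du x ^+ 2)%:E)%E.
Proof.
move=> eps0 uM ud cdu.
have cu : continuous u by move=> x; exact: is_derive_continuous (ud x).
pose h x := u x ^+ 2 + eps.
have ch : continuous h.
  by apply: continuous_add; [exact: continuous_sqr|exact: continuous_const].
have mh : measurable_fun [set: measurableTypeR R] h.
  exact: continuous_measurable_fun.
have h_ge x : eps <= h x by rewrite lerDr sqr_ge0.
have h_le x : h x <= M ^+ 2 + eps.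
  exact: sqr_eps_le.
have h0 x : 0 < h x by rewrite (lt_le_trans eps0).
set c := (\int[P]_x h x)%R.
have cE : (\int[P]_x (h x)%:E = c%:E)%E.
  exact: (@meanE _ _ _ P h eps (M ^+ 2 + eps)).
have c0 : 0 < c by exact: (@mean_gt0 _ _ _ P h eps (M ^+ 2 + eps)).
have mb : measurable_fun [set: measurableTypeR R] (fun x => (bregman (h x) c)%:E).
  apply/measurable_EFinP.
  exact: (@measurable_bregman R _ (measurableTypeR R) h c mh).
have crd : continuous (fun x => r x ^+ 2 * du x ^+ 2).
  by apply: continuous_mul; exact: continuous_sqr.
have md : measurable_fun [set: measurableTypeR R]
    (fun x => (r x ^+ 2 * du x ^+ 2)%:E).
  by apply/measurable_EFinP; exact: continuous_measurable_fun.
have mhE : measurable_fun [set: measurableTypeR R] (EFin \o h).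
  exact/measurable_EFinP.
have b0 x : (0 <= (bregman (h x) c)%:E)%E by rewrite lee_fin bregman_ge0.
have d0 x : (0 <= (r x ^+ 2 * du x ^+ 2)%:E)%E.
  by rewrite lee_fin mulr_ge0 ?sqr_ge0.
have h0E x : (0 <= (EFin \o h) x)%E by rewrite lee_fin ltW.
rewrite /entropy_gap -/c (PE mb b0) (PE md d0).
have cE' : (\int[mu]_x ((u x ^+ 2 + eps) * p x)%:E = c%:E)%E.
  by rewrite -cE (PE mhE h0E).
exact: (lsi_line eps0 uM ud cdu cE').
Qed.

End weighted_lsi.

(** * Integration over row vectors *)

Section measurable_continuous_rV.
Context {R : realType} {n : nat}.

Let grid (k : nat) (x : 'rV[R]_n) : 'rV[R]_n :=
  \row_i ((Num.floor (k.+1%:R * x ord0 i))%:~R / k.+1%:R).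

Let cvg_grid (x : 'rV[R]_n) : grid k x @[k --> \oo] --> x.
Proof.
apply/cvg_ballP => e e0; near=> k; split => // i j.
rewrite (ord1 i) mxE /ball/= distrC.
have k0 : (0 : R) < k.+1%:R by rewrite ltr0n.
have := floor_itv (k.+1%:R * x ord0 j) => /andP[].
rewrite intrD mulr1z => fl fu.
set m := (Num.floor _)%:~R in fl fu *.
have -> : m / k.+1%:R - x ord0 j = (m - k.+1%:R * x ord0 j) / k.+1%:R.
  by field; rewrite gt_eqF.
rewrite normrM normfV (gtr0_norm k0) ltr_pdivrMr//.
have -> : `|m - k.+1%:R * x ord0 j| = k.+1%:R * x ord0 j - m.
  by rewrite ler0_norm ?opprB// subr_le0.
apply: (@lt_le_trans _ _ 1); first lra.
rewrite -ler_pdivrMr// div1r ltW//.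
near: k; exact: near_infty_natSinv_lt (PosNum e0).
Unshelve. all: by end_near. Qed.

(** The sigma-algebra is generated by the coordinates, not by the open sets.
    Rounding the coordinates to multiples of 1/(k+1) turns [f] into a function
    that is constant on countably many products of intervals, and these
    functions converge to [f] as [f] is continuous. *)
Lemma continuous_measurable_rV (f : 'rV[R]_n -> R) :
  continuous f -> measurable_fun setT f.
Proof.
move=> cf; apply: (@measurable_fun_cvg _ _ _ setT (fun k => f \o grid k)).
  move=> k _ B mB; rewrite setTI.
  pose cell (z : 'rV[int]_n) := [set x : 'rV[R]_n |
    forall i, Num.floor (k.+1%:R * x ord0 i) = z ord0 i].
  pose node (z : 'rV[int]_n) : 'rV[R]_n := \row_i ((z ord0 i)%:~R / k.+1%:R).
  rewrite (_ : _ @^-1` B =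
      \bigcup_(z in [set: 'rV[int]_n]) (cell z `&` [set _ | B (f (node z))])).
    apply: countable_bigcupT_measurable => // z.
    apply: measurableI; last first.
      have [Bz|nBz] := pselect (B (f (node z))).
        by rewrite (_ : [set _ | _] = setT)//; apply/seteqP; split.
      by rewrite (_ : [set _ | _] = set0)//; apply/seteqP; split.
    rewrite (_ : cell z = \bigcap_(i in setT)
      ((fun x : 'rV[R]_n => x ord0 i : measurableTypeR R) @^-1`
        (`[(z ord0 i)%:~R / k.+1%:R, (z ord0 i + 1)%:~R / k.+1%:R[%classic))).
      apply: fin_bigcap_measurable => // i _.
      by rewrite -[X in measurable X]setTI; exact: measurable_coord_rV.
    have k0 : (0 : R) < k.+1%:R by rewrite ltr0n.
    apply/seteqP; split => [x xz i _ /=|x xz i].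
      rewrite in_itv/= ler_pdivrMr// ltr_pdivlMr// mulrC -(xz i).
      exact: floor_itv.
    have := xz i Logic.I; rewrite /= in_itv/= ler_pdivrMr// ltr_pdivlMr// mulrC.
    by rewrite -floor_eq => /eqP.
  apply/seteqP; split => [x /= Bx|x [z _ [xz /= Bz]]].
    exists (\row_i Num.floor (k.+1%:R * x ord0 i)) => //; split=> [i|].
      by rewrite mxE.
    rewrite /= (_ : node _ = grid k x)//.
    by apply/rowP => i; rewrite !mxE.
  rewrite /= (_ : grid k x = node z)//.
  by apply/rowP => i; rewrite !mxE xz.
move=> x _; apply: (@continuous_cvg _ _ _ _ _ (grid ^~ x) f); first exact: cf.
exact: cvg_grid.
Qed.

End measurable_continuous_rV.

Section lebesgue_rV_integral.
Context {R : realType}.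
Let mu := @lebesgue_measure R.
Local Open Scope ereal_scope.

Lemma ge0_integral_lebesgue_rVS n (phi : 'rV[R]_n.+1 -> \bar R) :
  measurable_fun setT phi -> (forall x, 0 <= phi x) ->
  \int[lebesgue_rV (n:=n.+1)]_x phi x =
  \int[mu]_a \int[lebesgue_rV (n:=n)]_y phi (cons_rV (a, y)).
Proof.
move=> mphi phi0.
have mc := @measurable_cons_rV R n.
transitivity (\int[pushforward (mu \x lebesgue_rV (n:=n)) (@cons_rV R n)]_x phi x).
  by apply: eq_measure_integral => A mA _.
rewrite (ge0_integral_pushforward mc)//= preimage_setT.
rewrite fubini_tonelli1//.
exact: (measurableT_comp mphi mc).
Qed.

Lemma ge0_integral_lebesgue_rV0 (phi : 'rV[R]_0 -> \bar R) :
  measurable_fun setT phi -> (forall x, 0 <= phi x) ->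
  \int[lebesgue_rV (n:=0)]_x phi x = phi 0%R.
Proof.
move=> mphi phi0.
transitivity (\int[\d_ (0%R : 'rV[R]_0)]_x phi x).
  by apply: eq_measure_integral => A mA _.
by rewrite integral_dirac// diracT mul1e.
Qed.

Lemma lebesgue_measure_affine (a b : R) (A : set (measurableTypeR R)) :
  (0 < a)%R -> measurable A ->
  mu A = a%:E * mu ((fun x : R => a * x + b)%R @^-1` A).
Proof.
move=> a0 mA.
pose T := (fun x : measurableTypeR R => (a * x + b)%R : measurableTypeR R).
have mT : measurable_fun [set: measurableTypeR R] T.
  by apply: measurable_funD => //; exact: measurable_funM.
apply: (@lebesgue_measure_unique R
  (mscale (NngNum (ltW a0)) (pushforward mu T))) => // _ [[u v]] _ <-.
transitivity (a%:E * mu (T @^-1` `]u, v]%classic)); last by [].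
rewrite (_ : T @^-1` _ = `]((u - b) / a)%R, ((v - b) / a)%R]%classic); last first.
  apply/seteqP; split => x /=; rewrite !in_itv/= ltr_pdivrMr// ler_pdivlMr//;
    by rewrite ltrBlDr lerBrDr (mulrC x).
rewrite /mu !lebesgue_measure_itv/= !lte_fin ltr_pM2r ?invr_gt0// ltrD2r.
case: ifPn => uv; last by rewrite mule0.
by rewrite -!EFinD -EFinM; congr EFin; field; rewrite gt_eqF.
Qed.

Lemma ge0_integral_affine (a b : R) (phi : R -> \bar R) :
  (0 < a)%R -> measurable_fun [set: measurableTypeR R] phi ->
  (forall x, 0 <= phi x) ->
  \int[mu]_x phi (a * x + b)%R = a^-1%:E * \int[mu]_x phi x.
Proof.
move=> a0 mphi phi0.
pose T := (fun x : measurableTypeR R => (a * x + b)%R : measurableTypeR R).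
have mT : measurable_fun [set: measurableTypeR R] T.
  by apply: measurable_funD => //; exact: measurable_funM.
pose m : {measure set (measurableTypeR R) -> \bar R} := pushforward mu T.
have -> : \int[mu]_x phi x = a%:E * \int[m mT]_x phi x.
  rewrite -(@ge0_integral_mscale _ _ _ (m mT) _ measurableT (NngNum (ltW a0)))//.
  apply: (@eq_measure_integral _ _ _ _ (mscale (NngNum (ltW a0)) (m mT))) => A mA _.
  exact: lebesgue_measure_affine.
rewrite (ge0_integral_pushforward mT)//= preimage_setT.
by rewrite muleA -EFinM mulVf ?gt_eqF// mul1e.
Qed.

Lemma cons_rVZ n (l a : R) (y : 'rV[R]_n) :
  cons_rV ((l * a)%R, (l *: y)%R) = (l *: cons_rV (a, y))%R.
Proof.
apply/rowP => i; rewrite [RHS]mxE; case: (unliftP ord0 i) => [j|] ->.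
  by rewrite !cons_rVS mxE.
by rewrite !cons_rV0.
Qed.

Lemma measurable_rVZ n (l : R) :
  measurable_fun setT (fun x : 'rV[R]_n => (l *: x)%R).
Proof.
apply/measurable_fun_rVP => i.
under eq_fun do rewrite mxE.
by apply: measurable_funM => //; exact: measurable_coord_rV.
Qed.

Lemma ge0_integral_rVZ n (l : R) (phi : 'rV[R]_n -> \bar R) :
  (0 < l)%R -> measurable_fun setT phi -> (forall x, 0 <= phi x) ->
  \int[lebesgue_rV (n:=n)]_x phi (l *: x)%R =
  (l ^- n)%:E * \int[lebesgue_rV (n:=n)]_x phi x.
Proof.
move=> l0; elim: n phi => [|n IH] phi mphi phi0.
  rewrite !ge0_integral_lebesgue_rV0//; last first.
    exact: (measurableT_comp mphi (measurable_rVZ l)).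
  by rewrite scaler0 expr0 invr1 mul1e.
have mphil : measurable_fun setT (fun x : 'rV[R]_n.+1 => phi (l *: x)%R).
  exact: (measurableT_comp mphi (measurable_rVZ l)).
rewrite !ge0_integral_lebesgue_rVS//.
have mphic : measurable_fun setT
    (fun p : measurableTypeR R * 'rV[R]_n => phi (cons_rV p)).
  exact: (measurableT_comp mphi (@measurable_cons_rV R n)).
pose G (a : measurableTypeR R) := \int[lebesgue_rV (n:=n)]_y phi (cons_rV (a, y)).
have mG : measurable_fun [set: measurableTypeR R] G.
  exact: (measurable_fun_fubini_tonelli_F (fun p => phi (cons_rV p))).
have G0 a : 0 <= G a by exact: integral_ge0.
transitivity (\int[mu]_a ((l ^- n)%:E * G (l * a + 0)%R)).
  apply: eq_integral => a _; rewrite addr0 /G -IH//.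
  - by apply: eq_integral => y _; rewrite cons_rVZ.
  - exact: (measurableT_comp mphic (pair1_measurable _)).
rewrite -[X in _ * X]/(\int[mu]_a G a); move: G mG G0 => G mG G0.
pose T := (fun a : measurableTypeR R => (l * a + 0)%R : measurableTypeR R).
have mT : measurable_fun [set: measurableTypeR R] T.
  by apply: measurable_funD => //; exact: measurable_funM.
have mGT : measurable_fun [set: measurableTypeR R] (fun a => G (l * a + 0)%R).
  exact: (measurableT_comp mG mT).
rewrite (ge0_integralZl mu measurableT mGT)//; last first.
  by rewrite lee_fin invr_ge0 exprn_ge0// ltW.
by rewrite (ge0_integral_affine 0 l0 mG G0) muleA -EFinM -invfM exprSr.
Qed.

End lebesgue_rV_integral.

(** * The Gaussian law *)

Section line_gauss.
Context {R : realType}.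
Let mu := @lebesgue_measure R.

(** Normalised without the factor 1/2 in the exponent: the logarithmic Sobolev
    constant is then 1, and |e^(t/2) x|^2 = e^t |x|^2 fits the log-gamma law. *)
Definition gauss_pdf (x : R) : R := (Num.sqrt pi)^-1 * expR (- x ^+ 2).

Lemma gauss_pdf_gt0 x : 0 < gauss_pdf x.
Proof. by rewrite mulr_gt0 ?expR_gt0// invr_gt0 sqrtr_gt0 pi_gt0. Qed.

Lemma is_derive_gauss_pdf (x : R) :
  is_derive x 1 gauss_pdf (- (2 * x * gauss_pdf x)).
Proof.
rewrite /gauss_pdf; apply: is_derive_eq; rewrite /GRing.scale/=; ring.
Qed.

Lemma continuous_gauss_pdf : continuous gauss_pdf.
Proof. by move=> x; exact: is_derive_continuous (is_derive_gauss_pdf x). Qed.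

Lemma integral_gauss_pdf : (\int[mu]_x (gauss_pdf x)%:E = 1)%E.
Proof.
have s0 : 0 < Num.sqrt pi :> R by rewrite sqrtr_gt0 pi_gt0.
under eq_integral do rewrite EFinM.
rewrite ge0_integralZl//.
- by rewrite integralT_gauss -EFinM mulVf ?gt_eqF.
- by apply/measurable_EFinP; exact: measurable_gauss_fun.
Qed.

(** The unweighted case, with [Y] the identity and [rho = 2]. *)
Lemma gauss_line_lsi (P : probability (measurableTypeR R) R)
    (M eps : R) (u du : R -> R) :
  (forall phi : R -> \bar R, measurable_fun [set: measurableTypeR R] phi ->
    (forall x, 0 <= phi x)%E ->
    \int[P]_x phi x = \int[mu]_x (phi x * (gauss_pdf x)%:E))%E ->
  0 < eps -> (forall x, `|u x| <= M) ->
  (forall x : R, is_derive x 1 u (du x)) -> continuous du ->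
  (entropy_gap P (fun x => u x ^+ 2 + eps)%R <= \int[P]_x (du x ^+ 2)%:E)%E.
Proof.
move=> PE eps0 uM ud cdu.
have Yd (x : R) : is_derive x 1 (id : R -> R) (1 : R)^-1.
  by rewrite invr1; exact: is_derive_id.
have Pd (x : R) : is_derive x 1 (fun y : R => gauss_pdf y * 1)
    (- (2 * x * gauss_pdf x)).
  by under eq_fun do rewrite mulr1; exact: is_derive_gauss_pdf.
have conv x t : ln (gauss_pdf t * 1) <=
    ln (gauss_pdf x * 1) - 2 * x * (t - x) - 2 / 2 * (t - x) ^+ 2.
  have s0 : (Num.sqrt pi)^-1 \is @Num.pos R by rewrite posrE invr_gt0 sqrtr_gt0 pi_gt0.
  rewrite !mulr1 /gauss_pdf !lnM ?posrE ?expR_gt0// !expRK; lra.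
have r0 (x : R) : (0 : R) < 1 by [].
have := probability_lsi_line (ltr0n R 2) gauss_pdf_gt0 r0 continuous_gauss_pdf
  (@continuous_const R 1) Yd Pd conv integral_gauss_pdf PE eps0 uM ud cdu.
rewrite divff ?pnatr_eq0// mul1e => lsi; apply: (le_trans lsi).
by under eq_integral do rewrite expr1n mul1r.
Qed.

End line_gauss.

Section gauss_rV.
Context {R : realType}.
Let mu := @lebesgue_measure R.

Definition gauss_pdf_rV n (x : 'rV[R]_n) : R := \prod_i gauss_pdf (x ord0 i).

Lemma gauss_pdf_rV_gt0 n (x : 'rV[R]_n) : 0 < gauss_pdf_rV x.
Proof. by apply: prodr_gt0 => i _; exact: gauss_pdf_gt0. Qed.

Lemma measurable_gauss_pdf_rV n : measurable_fun setT (@gauss_pdf_rV n).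
Proof.
apply: measurable_prod => i _.
apply: measurableT_comp; last exact: measurable_coord_rV.
apply: continuous_measurable_fun; exact: continuous_gauss_pdf.
Qed.

Lemma gauss_pdf_rV_cons n (p : measurableTypeR R * 'rV[R]_n) :
  gauss_pdf_rV (cons_rV p) = gauss_pdf p.1 * gauss_pdf_rV p.2.
Proof.
rewrite /gauss_pdf_rV big_ord_recl cons_rV0; congr (_ * _).
by apply: eq_bigr => i _; rewrite cons_rVS.
Qed.

Lemma ge0_integral_gauss_rVS n (phi : 'rV[R]_n.+1 -> \bar R) :
  measurable_fun setT phi -> (forall x, 0 <= phi x)%E ->
  (\int[lebesgue_rV (n:=n.+1)]_x (phi x * (gauss_pdf_rV x)%:E) =
   \int[mu]_a ((\int[lebesgue_rV (n:=n)]_y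
     (phi (cons_rV (a, y)) * (gauss_pdf_rV y)%:E)) * (gauss_pdf a)%:E))%E.
Proof.
move=> mphi phi0.
have mg m := @measurable_gauss_pdf_rV m.
have g0 m x := ltW (@gauss_pdf_rV_gt0 m x).
rewrite ge0_integral_lebesgue_rVS//; first last.
- by move=> x; rewrite mule_ge0// lee_fin g0.
- by apply: emeasurable_funM => //; apply/measurable_EFinP; exact: mg.
apply: eq_integral => a _.
have mphia : measurable_fun setT (fun y : 'rV[R]_n => phi (cons_rV (a, y))).
  apply: (measurableT_comp mphi).
  exact: (measurableT_comp (@measurable_cons_rV R n) (pair1_measurable _)).
rewrite -ge0_integralZr//; first last.
- by rewrite lee_fin ltW// gauss_pdf_gt0.
- by move=> y _; rewrite mule_ge0// lee_fin g0.
- by apply: emeasurable_funM => //; apply/measurable_EFinP; exact: mg.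
apply: eq_integral => y _.
by rewrite gauss_pdf_rV_cons/= EFinM (muleC (gauss_pdf a)%:E) muleA.
Qed.

Lemma integral_gauss_pdf_rV n :
  (\int[lebesgue_rV (n:=n)]_x (gauss_pdf_rV x)%:E = 1)%E.
Proof.
elim: n => [|n IH].
  rewrite ge0_integral_lebesgue_rV0.
  - by rewrite /gauss_pdf_rV big_ord0.
  - by apply/measurable_EFinP; exact: measurable_gauss_pdf_rV.
  - by move=> x; rewrite lee_fin ltW// gauss_pdf_rV_gt0.
under eq_integral do rewrite -[_%:E]mul1e.
rewrite ge0_integral_gauss_rVS//.
under eq_integral => a _.
  under eq_integral do rewrite mul1e.
  rewrite IH mul1e; over.
exact: integral_gauss_pdf.
Qed.

End gauss_rV.

Section gauss_measures.
Context {R : realType}.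
Let mu := @lebesgue_measure R.
Local Open Scope ereal_scope.

Let gauss_line_sig : {P : probability (measurableTypeR R) R |
  forall phi : R -> \bar R, measurable_fun [set: measurableTypeR R] phi ->
  (forall x, 0 <= phi x) ->
  \int[P]_x phi x = \int[mu]_x (phi x * (gauss_pdf x)%:E)}.
Proof.
apply: (@probability_of_density _ (measurableTypeR R) R mu gauss_pdf).
- apply: continuous_measurable_fun; exact: continuous_gauss_pdf.
- by move=> x; rewrite ltW// gauss_pdf_gt0.
- exact: integral_gauss_pdf.
Qed.

Definition gauss_line := sval gauss_line_sig.

Lemma gauss_lineE (phi : R -> \bar R) :
  measurable_fun [set: measurableTypeR R] phi -> (forall x, 0 <= phi x) ->
  \int[gauss_line]_x phi x = \int[mu]_x (phi x * (gauss_pdf x)%:E).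
Proof. exact: (svalP gauss_line_sig). Qed.

Let gauss_rV_sig n : {P : probability 'rV[R]_n R |
  forall phi, measurable_fun setT phi -> (forall x, 0 <= phi x) ->
  \int[P]_x phi x =
  \int[lebesgue_rV (n:=n)]_x (phi x * (gauss_pdf_rV x)%:E)}.
Proof.
apply: probability_of_density.
- exact: measurable_gauss_pdf_rV.
- by move=> x; rewrite ltW// gauss_pdf_rV_gt0.
- exact: integral_gauss_pdf_rV.
Qed.

Definition gauss_rV n := sval (gauss_rV_sig n).

Lemma gauss_rVE n (phi : 'rV[R]_n -> \bar R) :
  measurable_fun setT phi -> (forall x, 0 <= phi x) ->
  \int[gauss_rV n]_x phi x =
  \int[lebesgue_rV (n:=n)]_x (phi x * (gauss_pdf_rV x)%:E).
Proof. exact: (svalP (gauss_rV_sig n)). Qed.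

Lemma measurable_slice_rV n d (U : measurableType d) (phi : 'rV[R]_n.+1 -> U) a :
  measurable_fun setT phi ->
  measurable_fun setT (fun y : 'rV[R]_n => phi (cons_rV (a, y))).
Proof.
move=> mphi; apply: (measurableT_comp mphi).
exact: (measurableT_comp (@measurable_cons_rV R n) (pair1_measurable _)).
Qed.

Lemma gauss_rVS n (phi : 'rV[R]_n.+1 -> \bar R) :
  measurable_fun setT phi -> (forall x, 0 <= phi x) ->
  \int[gauss_rV n.+1]_x phi x =
  \int[gauss_line]_a \int[gauss_rV n]_y phi (cons_rV (a, y)).
Proof.
move=> mphi phi0; rewrite gauss_rVE// ge0_integral_gauss_rVS// gauss_lineE.
- apply: eq_integral => a _; rewrite gauss_rVE//.
  exact: measurable_slice_rV.
- apply: (measurable_fun_fubini_tonelli_F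
    (fun p : measurableTypeR R * 'rV[R]_n => phi (cons_rV p))) => //.
  exact: (measurableT_comp mphi (@measurable_cons_rV R n)).
- by move=> a; exact: integral_ge0.
Qed.

End gauss_measures.

Section gauss_lsi.
Context {R : realType}.

(** Continuous differentiability along the coordinate lines: the form of
    regularity that tensorization consumes one coordinate at a time, and that is
    inherited by slices. *)
Definition C1_slices n (f : 'rV[R]_n -> R) (D : 'I_n -> 'rV[R]_n -> R) :=
  forall i (x : 'rV[R]_n),
    (forall a : R, is_derive a 1 (fun a => f (x + a *: delta_mx ord0 i))
       (D i (x + a *: delta_mx ord0 i))) /\
    continuous (fun a : R => D i (x + a *: delta_mx ord0 i)).

Lemma cons_rV_head n (a : R) (y : 'rV[R]_n) :
  cons_rV (a, y) = cons_rV (0, y) + a *: delta_mx ord0 ord0.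
Proof.
apply/rowP => i; rewrite [RHS]mxE; case: (unliftP ord0 i) => [j|] ->.
  by rewrite !cons_rVS !mxE/= mulr0 addr0.
by rewrite !cons_rV0 !mxE/= mulr1 add0r.
Qed.

Lemma cons_rV_tail n (a b : R) (y : 'rV[R]_n) j :
  cons_rV (a, y + b *: delta_mx ord0 j) =
  cons_rV (a, y) + b *: delta_mx ord0 (lift ord0 j).
Proof.
apply/rowP => i; rewrite [RHS]mxE; case: (unliftP ord0 i) => [k|] ->.
  by rewrite !cons_rVS !mxE/= (inj_eq (@lift_inj _ _)).
by rewrite !cons_rV0 !mxE/= mulr0 addr0.
Qed.

(** Induction on the dimension: the first coordinate is split off by
    [entropy_gap_tensor] and handled by the inequality on the line. *)
Lemma gauss_rV_lsi n (f : 'rV[R]_n -> R) D (M eps : R) : 0 < eps ->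
  measurable_fun setT f -> (forall x, `|f x| <= M) ->
  (forall i, measurable_fun setT (D i)) -> C1_slices f D ->
  (entropy_gap (gauss_rV n) (fun x => f x ^+ 2 + eps)%R <=
   \int[gauss_rV n]_x (\sum_i D i x ^+ 2)%:E)%E.
Proof.
move=> eps0; elim: n f D => [|n IH] f D mf fM mD fD.
  rewrite /entropy_gap.
  set c := Rintegral _ _ _.
  pose k := f 0 ^+ 2 + eps.
  have k0 : 0 < k by rewrite ltr_wpDl// sqr_ge0.
  have fE (x : 'rV[R]_0) : f x ^+ 2 + eps = k by rewrite [x]thinmx0.
  have -> : c = k.
    rewrite /c /Rintegral; under eq_integral do rewrite fE.
    by rewrite probability_integral_cst.
  rewrite integral0_eq ?integral_ge0// => x _.
    by rewrite lee_fin sumr_ge0// => i _; exact: sqr_ge0.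
  by rewrite fE /bregman divff ?gt_eqF// ln1 mulr0 sub0r addNr.
pose h a y := f (cons_rV (a, y)) ^+ 2 + eps.
have mfc : measurable_fun setT
    (fun p : measurableTypeR R * 'rV[R]_n => f (cons_rV p)).
  exact: (measurableT_comp mf (@measurable_cons_rV R n)).
have mDc i : measurable_fun setT
    (fun p : measurableTypeR R * 'rV[R]_n => D i (cons_rV p)).
  exact: (measurableT_comp (mD i) (@measurable_cons_rV R n)).
pose A a y := (D ord0 (cons_rV (a, y)) ^+ 2)%:E.
pose B a y := (\sum_j D (lift ord0 j) (cons_rV (a, y)) ^+ 2)%:E.
have mh : measurable_fun setT (fun x => f x ^+ 2 + eps) by exact: measurable_sqr_eps.
have h_ge x : eps <= f x ^+ 2 + eps by rewrite lerDr sqr_ge0.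
have h_le x : f x ^+ 2 + eps <= M ^+ 2 + eps by exact: sqr_eps_le.
set c := (\int[gauss_rV n.+1]_x (f x ^+ 2 + eps))%R.
have cE : (\int[gauss_rV n.+1]_x (f x ^+ 2 + eps)%:E = c%:E)%E.
  exact: (@meanE _ _ _ (gauss_rV n.+1) (fun x => f x ^+ 2 + eps) eps (M ^+ 2 + eps)).
have c0 : 0 < c.
  exact: (@mean_gt0 _ _ _ (gauss_rV n.+1) (fun x => f x ^+ 2 + eps) eps (M ^+ 2 + eps)).
have h0 x : 0 < f x ^+ 2 + eps by rewrite (lt_le_trans eps0).
rewrite /entropy_gap -/c gauss_rVS; first last.
- by move=> x; rewrite lee_fin bregman_ge0.
- by apply/measurable_EFinP; exact: measurable_bregman.
rewrite gauss_rVS; first last.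
- by move=> x; rewrite lee_fin sumr_ge0// => i _; exact: sqr_ge0.
- apply/measurable_EFinP; apply: measurable_sum => i; exact: measurable_funX.
apply: (@le_trans _ _ (\int[gauss_line]_a \int[gauss_rV n]_y (A a y + B a y))%E).
  apply: (@entropy_gap_tensor _ _ _ _ _ gauss_line (gauss_rV n) h eps (M ^+ 2 + eps) A B) => //.
  - exact: (measurable_sqr_eps _ mfc).
  - by move=> a y; exact: h_ge.
  - by move=> a y; exact: h_le.
  - by apply/measurable_EFinP; apply: measurable_funX; exact: mDc.
  - apply/measurable_EFinP; apply: measurable_sum => j; apply: measurable_funX.
    exact: mDc.
  - by move=> a y; rewrite lee_fin sqr_ge0.
  - by move=> a y; rewrite lee_fin sumr_ge0// => i _; exact: sqr_ge0.
  - move=> y; have [fd cd] := fD ord0 (cons_rV (0, y)).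
    apply: (gauss_line_lsi (u := fun a => f (cons_rV (a, y)))
      (du := fun a => D ord0 (cons_rV (a, y))) gauss_lineE eps0) => //.
    + move=> a; rewrite (cons_rV_head a y).
      rewrite (_ : (fun _ => _) = fun a =>
        f (cons_rV (0, y) + a *: delta_mx ord0 ord0)); first exact: fd.
      by apply/funext => b; rewrite (cons_rV_head b y).
    + rewrite (_ : (fun _ => _) = fun a =>
        D ord0 (cons_rV (0, y) + a *: delta_mx ord0 ord0)); first exact: cd.
      by apply/funext => b; rewrite (cons_rV_head b y).
  - move=> a; apply: IH => //.
    + exact: measurable_slice_rV.
    + by move=> j; exact: measurable_slice_rV.
    + move=> j y; have [fd cd] := fD (lift ord0 j) (cons_rV (a, y)); split.
        move=> b; rewrite (cons_rV_tail a b y).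
        rewrite (_ : (fun _ => _) = fun b =>
          f (cons_rV (a, y) + b *: delta_mx ord0 (lift ord0 j))); first exact: fd.
        by apply/funext => b'; rewrite (cons_rV_tail a b' y).
      rewrite (_ : (fun _ => _) = fun b =>
        D (lift ord0 j) (cons_rV (a, y) + b *: delta_mx ord0 (lift ord0 j))).
        exact: cd.
      by apply/funext => b'; rewrite (cons_rV_tail a b' y).
  - rewrite -cE gauss_rVS//.
      by apply/measurable_EFinP.
    by move=> x; rewrite lee_fin ltW.
under [leRHS]eq_integral => a _.
  under eq_integral do rewrite big_ord_recl EFinD.
  over.
exact: lexx.
Qed.

End gauss_lsi.

(** * The log-gamma law *)

Section log_gamma.
Context {R : realType}.
Variable a : R.
Hypothesis a0 : 0 < a.

(** With z = e^t/(a+1) this is z - ln z, the shift of a convex function with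
    minimum 1. Its linear growth at minus infinity is the source of the logarithm
    of omega in the theorem. *)
Definition log_gamma_weight (t : R) : R := ln (a + 1) - t + expR t / (a + 1).

Let a1 : 0 < a + 1. Proof. by rewrite addr_gt0. Qed.

(** The curvature bound [rho = a / 2] for the log-gamma law, with [s = e^t],
    [d] the derivative of the weight [w], [V = s w] and [X] a square. After
    [V >= s] the two sides differ by exactly [(a + 1) * (d + 1) ^+ 2 / 2]. *)
Lemma log_gamma_curvature_ge (X V s d : R) : 0 <= X -> s * 1 <= V ->
  s = (a + 1) * (d + 1) ->
  a / 2 <= V + (s - a) * d / 2 - s / (a + 1) / 2 + X.
Proof.
move=> X0; rewrite mulr1 => sV sE.
have -> : s / (a + 1) = d + 1 by rewrite sE; field; rewrite gt_eqF.
have qq : 0 <= (a + 1) * (d + 1) ^+ 2.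
  by rewrite mulr_ge0 ?sqr_ge0// ltW.
apply: (@le_trans _ _ (s + (s - a) * d / 2 - (d + 1) / 2)); last lra.
rewrite sE; lra.
Qed.

Lemma log_gamma_weight_ge1 t : 1 <= log_gamma_weight t.
Proof.
have q0 : 0 < expR t / (a + 1) by rewrite divr_gt0// expR_gt0.
have := ln_le_subr1 q0; rewrite ln_div ?posrE ?expR_gt0// expRK /log_gamma_weight; lra.
Qed.

Lemma is_derive_log_gamma_weight (t : R) :
  is_derive t 1 log_gamma_weight (expR t / (a + 1) - 1).
Proof.
by rewrite /log_gamma_weight; apply: is_derive_eq; rewrite /GRing.scale/=; ring.
Qed.

(** With [r] the square root of the weight and [Y] an antiderivative of its
    inverse, the density of the log-gamma law satisfies the convexity that the
    transport argument needs, with [rho = a / 2]. *)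
Lemma log_gamma_transport (k : R) : 0 < k ->
  let p t := k * expR (a * t - expR t) in
  let r t := Num.sqrt (log_gamma_weight t) in
  exists Y Q : R -> R,
  [/\ continuous r, forall x, 0 < r x,
     forall x : R, is_derive x 1 Y (r x)^-1,
     forall x : R, is_derive x 1 (fun y : R => p y * r y) (- (Q x * p x)) &
     forall x t, ln (p t * r t) <=
       ln (p x * r x) - Q x * (Y t - Y x) - (a / 2) / 2 * (Y t - Y x) ^+ 2].
Proof.
move=> k0 p r.
have w1 := log_gamma_weight_ge1.
have w0 t : 0 < log_gamma_weight t by rewrite (lt_le_trans ltr01).
have r0 t : 0 < r t by rewrite sqrtr_gt0.
have p0 t : 0 < p t by rewrite mulr_gt0// expR_gt0.
pose dw (t : R) := expR t / (a + 1) - 1.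
have rr t : r t ^+ 2 = log_gamma_weight t by rewrite sqr_sqrtr// ltW.
have rd (t : R) : is_derive t 1 r (dw t / (2 * r t)).
  have ds := is_derive1_sqrt (w0 t); have dwt := is_derive_log_gamma_weight t.
  have := @is_derive1_comp _ (@Num.sqrt R) log_gamma_weight t _ _ ds dwt.
  by rewrite mulrC.
have cr : continuous r by move=> t; exact: is_derive_continuous (rd t).
have [Y Yd] := continuous_antiderivative (continuous_inv r0 cr).
pose Q t := (expR t - a) * r t - dw t / (2 * r t).
pose dQ t := expR t * r t + (expR t - a) * (dw t / (2 * r t)) -
  (expR t / (a + 1) / (2 * r t) - dw t * (dw t / (2 * r t)) / (2 * r t ^+ 2)).
exists Y, Q.
have Pd (x : R) : is_derive x 1 (fun y : R => p y * r y) (- (Q x * p x)).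
  have rx := rd x; rewrite /p; apply: is_derive_eq.
  by rewrite /GRing.scale/= /Q; field; rewrite gt_eqF.
have Qd (x : R) : is_derive x 1 Q (dQ x).
  have rx := rd x.
  have r20 : 2 * r x != 0 by rewrite gt_eqF// mulr_gt0.
  pose ir t := (2 * r t)^-1.
  have iv : is_derive x 1 ir (- (2 * r x) ^- 2 *: (2 * (dw x / (2 * r x)))).
    exact: is_deriveV.
  have dwd : is_derive x 1 dw (expR x / (a + 1)).
    by rewrite /dw; apply: is_derive_eq; rewrite /GRing.scale/=; ring.
  have -> : Q = (fun t => (expR t - a) * r t - dw t * ir t) by [].
  apply: is_derive_eq.
  by rewrite /GRing.scale/= /dQ /ir; field; rewrite !gt_eqF.
split => //; apply: (@transport_convexity _ _ _ _ _ _ dQ) => // t.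
have s0 := expR_gt0 t; have q0 : 0 < expR t / (a + 1) by rewrite divr_gt0.
have -> : r t * dQ t = expR t * r t ^+ 2 + (expR t - a) * dw t / 2
    - expR t / (a + 1) / 2 + dw t ^+ 2 / (4 * r t ^+ 2).
  by rewrite /dQ; field; rewrite !gt_eqF.
have sq : 0 <= dw t ^+ 2 / (4 * r t ^+ 2).
  by rewrite divr_ge0 ?sqr_ge0// mulr_ge0// sqr_ge0.
have sw : expR t * 1 <= expR t * r t ^+ 2 by rewrite ler_pM2l// rr.
set X := dw t ^+ 2 / (4 * _) in sq *; set V := expR t * r t ^+ 2 in sw *.
apply: (log_gamma_curvature_ge sq sw).
by rewrite /dw; field; rewrite gt_eqF.
Qed.

End log_gamma.

Section log_gamma_integral.
Context {R : realType}.
Let mu := @lebesgue_measure R.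

(** The substitution s = e^t turns its integral into Euler's integral for
    Gamma(b). *)
Definition log_gamma_fun (b t : R) : R := expR (b * t - expR t).

Lemma log_gamma_fun_gt0 b t : 0 < log_gamma_fun b t.
Proof. exact: expR_gt0. Qed.

Lemma is_derive_log_gamma_fun (b t : R) : is_derive t 1 (log_gamma_fun b)
  (b * log_gamma_fun b t - log_gamma_fun (b + 1) t).
Proof.
rewrite /log_gamma_fun; apply: is_derive_eq; rewrite /GRing.scale/=.
have -> : (b + 1) * t - expR t = (b * t - expR t) + t by ring.
rewrite [expR (_ + t)]expRD; ring.
Qed.

Lemma continuous_log_gamma_fun b : continuous (log_gamma_fun b).
Proof. by move=> t; exact: is_derive_continuous (is_derive_log_gamma_fun b t). Qed.

Lemma log_gamma_fun_le (b t : R) : 0 < b ->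
  log_gamma_fun b t <= expR (b * ln b - b).
Proof.
move=> b0; rewrite ler_expR.
have q0 : 0 < expR t / b by rewrite divr_gt0// expR_gt0.
have := ln_le_subr1 q0; rewrite ln_div ?posrE ?expR_gt0// expRK => /(ler_wpM2l (ltW b0)).
rewrite mulrBr [X in _ <= X]mulrBr mulr1 mulrCA divff ?gt_eqF// mulr1; lra.
Qed.

Let lg0 b t : 0 <= log_gamma_fun b t. Proof. exact/ltW/log_gamma_fun_gt0. Qed.

Let measurable_lg b : measurable_fun [set: measurableTypeR R]
  (fun t => (log_gamma_fun b t)%:E).
Proof.
by apply/measurable_EFinP; apply: continuous_measurable_fun;
  exact: continuous_log_gamma_fun.
Qed.

Let sym_lt n : - n.+1%:R < n.+1%:R :> R. Proof. by rewrite gtrN. Qed.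

(** The function is dominated by a multiple of the derivative of the bounded
    function [L]. *)
Lemma integral_log_gamma_fun_lty b : 0 < b ->
  (\int[mu]_t (log_gamma_fun b t)%:E < +oo)%E.
Proof.
move=> b0.
(* (1 + e^(b t))^2 <= 2 + 2 e^(2 b t), and exp(2 b t - e^t) is bounded *)
pose K := 2 + 2 * expR (2 * b * ln (2 * b) - 2 * b).
have K0 : 0 < K by rewrite addr_gt0// mulr_gt0// expR_gt0.
pose L (t : R) := 1 - (1 + expR (b * t))^-1.
pose dL (t : R) := b * expR (b * t) / (1 + expR (b * t)) ^+ 2.
have d0 (t : R) : 0 < 1 + expR (b * t) by rewrite addr_gt0// expR_gt0.
have Ld (t : R) : is_derive t 1 L (dL t).
  have n0 : 1 + expR (b * t) != 0 by rewrite gt_eqF.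
  have iv : is_derive t 1 (fun t => (1 + expR (b * t))^-1)
      (- (1 + expR (b * t)) ^- 2 *: (b * expR (b * t))).
    apply: is_deriveV => //.
    by apply: is_derive_eq; rewrite /GRing.scale/=; ring.
  by apply: is_derive_eq; rewrite /GRing.scale/= /dL; field.
have le_dL t : log_gamma_fun b t <= K / b * dL t.
  have -> : K / b * dL t = expR (b * t) * (K / (1 + expR (b * t)) ^+ 2).
    by rewrite /dL; field; rewrite !gt_eqF.
  rewrite /log_gamma_fun expRD ler_pM2l ?expR_gt0// ler_pdivlMr ?exprn_gt0//.
  have e1 : expR (- expR t) <= 1 by rewrite -expR0 ler_expR oppr_le0 expR_ge0.
  have e2 : expR (- expR t) * expR (b * t) ^+ 2 <= expR (2 * b * ln (2 * b) - 2 * b).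
    have := @log_gamma_fun_le (2 * b) t (mulr_gt0 (ltr0n R 2) b0).
    by rewrite /log_gamma_fun expRD mulrC expr2 -expRD -mulrDl -mulr2n mulr_natl.
  have sq : (1 + expR (b * t)) ^+ 2 <= 2 + 2 * expR (b * t) ^+ 2.
    rewrite -subr_ge0 (_ : _ - _ = (1 - expR (b * t)) ^+ 2) ?sqr_ge0//; ring.
  apply: (le_trans (ler_wpM2l (expR_ge0 _) sq)); rewrite /K; lra.
apply: (@le_lt_trans _ _ (K / b)%:E); last exact: ltry.
have cv := cvg_integral_sym_itv (@continuous_log_gamma_fun b) (lg0 b).
rewrite -(cvg_lim _ cv)//; apply: lime_le; first by apply/cvg_ex; eexists; exact: cv.
apply: nearW => n.
have [G Gd] := antiderivative_exists (- n.+1%:R) n.+1%:R (@continuous_log_gamma_fun b).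
rewrite (integral_itv_antiderivative (sym_lt n) (@continuous_log_gamma_fun b) Gd).
rewrite lee_fin.
suff : K / b * L (- n.+1%:R) - G (- n.+1%:R) <= K / b * L n.+1%:R - G n.+1%:R.
  have L1 : L n.+1%:R - L (- n.+1%:R) <= 1.
    have : (1 + expR (b * - n.+1%:R))^-1 <= 1.
      by rewrite invf_le1// lerDl expR_ge0.
    have : 0 <= (1 + expR (b * n.+1%:R))^-1 by rewrite invr_ge0 ltW.
    by rewrite /L; lra.
  have Kb : 0 <= K / b by rewrite divr_ge0 ?ltW.
  have := ler_wpM2l Kb L1; rewrite mulr1 mulrBr; lra.
apply: (deriv_le (f := fun t => K / b * L t - G t)
  (df := fun t => K / b * dL t - log_gamma_fun b t)) => [t /andP[nt tn]|t _|].
- have Lt := Ld t; have Gt : is_derive t 1 G (log_gamma_fun b t).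
    by apply: Gd; apply/andP; split; lra.
  by apply: is_derive_eq; rewrite /GRing.scale/=; ring.
- by rewrite subr_ge0.
- exact/ltW.
Qed.

Definition log_gamma_mass (b : R) : R := (\int[mu]_t log_gamma_fun b t)%R.

Lemma log_gamma_massE b : 0 < b ->
  (\int[mu]_t (log_gamma_fun b t)%:E = (log_gamma_mass b)%:E)%E.
Proof.
move=> b0; rewrite fineK// ge0_fin_numE ?integral_log_gamma_fun_lty//.
by apply: integral_ge0 => t _; rewrite lee_fin.
Qed.

Lemma log_gamma_mass_gt0 b : 0 < b -> 0 < log_gamma_mass b.
Proof.
move=> b0; rewrite -lte_fin -log_gamma_massE//.
apply: (@lt_le_trans _ _ (\int[mu]_(t in sym_itv 0) (log_gamma_fun b t)%:E)%E); last first.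
  apply: ge0_subset_integral => //; first exact: measurable_itv.
  by move=> t _; rewrite lee_fin.
have [G Gd] := antiderivative_exists (- 1%:R) 1%:R (@continuous_log_gamma_fun b).
rewrite (integral_itv_antiderivative (sym_lt 0) (@continuous_log_gamma_fun b) Gd).
rewrite lte_fin subr_gt0; apply: (deriv_lt (df := log_gamma_fun b)) => [t /andP[nt tn]|t _|].
- by apply: Gd; apply/andP; split; lra.
- exact: log_gamma_fun_gt0.
- exact: sym_lt.
Qed.

(** The functional equation of the Gamma function: the two sides differ by the
    integral of the derivative of [log_gamma_fun b], which vanishes at both
    ends. *)
Lemma log_gamma_massS b : 0 < b -> log_gamma_mass (b + 1) = b * log_gamma_mass b.
Proof.
move=> b0; have b10 : 0 < b + 1 by rewrite addr_gt0.
have I c : continuous (log_gamma_fun c) by exact: continuous_log_gamma_fun.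
have Ic c n : {y | (\int[mu]_(t in sym_itv n) (log_gamma_fun c t)%:E = y%:E)%E}.
  exists (fine (\int[mu]_(t in sym_itv n) (log_gamma_fun c t)%:E)%E).
  rewrite fineK//; apply: integrable_fin_num => //; first exact: measurable_itv.
  apply: continuous_compact_integrable; first exact: segment_compact.
  exact: continuous_subspaceT.
pose V c n := sval (Ic c n).
have VE c n : (\int[mu]_(t in sym_itv n) (log_gamma_fun c t)%:E = (V c n)%:E)%E.
  exact: svalP (Ic c n).
have Vcvg c : 0 < c -> V c @ \oo --> log_gamma_mass c.
  move=> c0; have := cvg_integral_sym_itv (I c) (lg0 c).
  rewrite log_gamma_massE// => /fine_cvgP[_].
  by under eq_fun do rewrite VE.
have rec n : V (b + 1) n =
    b * V b n - (log_gamma_fun b n.+1%:R - log_gamma_fun b (- n.+1%:R)).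
  have [G Gd] := antiderivative_exists (- n.+1%:R) n.+1%:R (I b).
  have := VE b n; rewrite (integral_itv_antiderivative (sym_lt n) (I b) Gd) => -[<-].
  pose S t := b * G t - log_gamma_fun b t.
  have Sd (t : R) : - n.+1%:R - 1 < t < n.+1%:R + 1 ->
      is_derive t 1 S (log_gamma_fun (b + 1) t).
    move=> tn; have Gt := Gd t tn; have lgt := is_derive_log_gamma_fun b t.
    by apply: is_derive_eq; rewrite /GRing.scale/=; ring.
  have := VE (b + 1) n.
  rewrite (integral_itv_antiderivative (sym_lt n) (I (b + 1)) Sd) => -[<-].
  by rewrite /S; ring.
have small (s : nat -> R) (K : R) : (forall n, 0 <= s n) ->
    (forall n, n.+1%:R * s n <= K) -> s @ \oo --> (0 : R).
  move=> s0 sK; apply: (@squeeze_cvgr _ _ _ _ (fun=> 0) (fun n => K * harmonic n)).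
  - apply: nearW => n; rewrite s0/= /harmonic/= ler_pdivlMr ?ltr0n//.
    by rewrite mulrC.
  - exact: cvg_cst.
  - by rewrite -[X in _ --> X](mulr0 K); apply: cvgMr; exact: cvg_harmonic.
(* both ends decay at least like 1/n: on the right by the bound for the
   exponent b + 1, on the left by n e^(-b n) <= 1/b *)
have s1 : log_gamma_fun b n.+1%:R @[n --> \oo] --> (0 : R).
  apply: (small _ (expR ((b + 1) * ln (b + 1) - (b + 1)))) => [//|n].
  apply: le_trans (log_gamma_fun_le n.+1%:R b10).
  have -> : log_gamma_fun (b + 1) n.+1%:R = expR n.+1%:R * log_gamma_fun b n.+1%:R.
    by rewrite /log_gamma_fun -expRD; congr expR; ring.
  rewrite ler_pM2r ?log_gamma_fun_gt0// (le_trans _ (expR_ge1Dx _))//.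
  by rewrite lerDr.
have s2 : log_gamma_fun b (- n.+1%:R) @[n --> \oo] --> (0 : R).
  apply: (small _ b^-1) => [//|n].
  apply: (@le_trans _ _ (n.+1%:R * expR (- (b * n.+1%:R)))).
    rewrite ler_pM2l ?ltr0n// ler_expR mulrN gerDl oppr_le0 expR_ge0//.
  rewrite expRN ler_pdivrMr ?expR_gt0// ler_pdivlMl//.
  by rewrite (le_trans _ (expR_ge1Dx _))// lerDr.
have V1 : V (b + 1) @ \oo --> b * log_gamma_mass b.
  rewrite (funext rec) -[X in _ --> X]subr0; apply: cvgB.
    by apply: cvgMr; exact: Vcvg.
  by rewrite -[X in _ --> X](subrr (0 : R)); exact: cvgB.
have V2 := Vcvg _ b10.
by rewrite -(cvg_lim (@Rhausdorff R) V1) (cvg_lim (@Rhausdorff R) V2).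
Qed.

End log_gamma_integral.

Section log_gamma_law.
Context {R : realType}.
Let mu := @lebesgue_measure R.
Variable a : R.
Hypothesis a0 : 0 < a.

Definition log_gamma_pdf (t : R) : R := (log_gamma_mass a)^-1 * log_gamma_fun a t.

Let mass0 : 0 < log_gamma_mass a. Proof. exact: log_gamma_mass_gt0. Qed.

Lemma log_gamma_pdf_gt0 t : 0 < log_gamma_pdf t.
Proof. by rewrite mulr_gt0 ?invr_gt0// log_gamma_fun_gt0. Qed.

Lemma continuous_log_gamma_pdf : continuous log_gamma_pdf.
Proof.
by apply: continuous_mul; [exact: continuous_const|exact: continuous_log_gamma_fun].
Qed.

Lemma integral_log_gamma_pdf : (\int[mu]_t (log_gamma_pdf t)%:E = 1)%E.
Proof.
under eq_integral do rewrite EFinM.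
rewrite ge0_integralZl//.
- by rewrite log_gamma_massE// -EFinM mulVf ?gt_eqF.
- apply/measurable_EFinP; apply: continuous_measurable_fun.
  exact: continuous_log_gamma_fun.
- by move=> t _; rewrite lee_fin ltW// log_gamma_fun_gt0.
- by rewrite lee_fin invr_ge0 ltW.
Qed.

Lemma log_gamma_law_exists : {P : probability (measurableTypeR R) R |
  forall phi : R -> \bar R, measurable_fun [set: measurableTypeR R] phi ->
  (forall x, 0 <= phi x)%E ->
  (\int[P]_x phi x = \int[mu]_x (phi x * (log_gamma_pdf x)%:E))%E}.
Proof.
apply: (@probability_of_density _ (measurableTypeR R) R mu log_gamma_pdf).
- by apply: continuous_measurable_fun; exact: continuous_log_gamma_pdf.
- by move=> x; rewrite ltW// log_gamma_pdf_gt0.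
- exact: integral_log_gamma_pdf.
Qed.

Lemma log_gamma_lsi (P : probability (measurableTypeR R) R)
    (M eps : R) (u du : R -> R) :
  (forall phi : R -> \bar R, measurable_fun [set: measurableTypeR R] phi ->
    (forall x, 0 <= phi x)%E ->
    \int[P]_x phi x = \int[mu]_x (phi x * (log_gamma_pdf x)%:E))%E ->
  0 < eps -> (forall x, `|u x| <= M) ->
  (forall x : R, is_derive x 1 u (du x)) -> continuous du ->
  (entropy_gap P (fun x => u x ^+ 2 + eps)%R <=
   (4 / a)%:E * \int[P]_x (log_gamma_weight a x * du x ^+ 2)%:E)%E.
Proof.
move=> PE eps0 uM ud cdu.
have k0 : 0 < (log_gamma_mass a)^-1 by rewrite invr_gt0.
have [Y [Q [cr r0 Yd Pd conv]]] := log_gamma_transport a0 k0.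
have a20 : 0 < a / 2 by rewrite divr_gt0.
have := probability_lsi_line a20 log_gamma_pdf_gt0 r0 continuous_log_gamma_pdf
  cr Yd Pd conv integral_log_gamma_pdf PE eps0 uM ud cdu.
have -> : 2 / (a / 2) = 4 / a by field; rewrite gt_eqF.
under [in leRHS]eq_integral => x _.
  rewrite sqr_sqrtr; last by rewrite (le_trans _ (log_gamma_weight_ge1 a0 x)).
  over.
by [].
Qed.

End log_gamma_law.

Section log_gamma_scaled.
Context {R : realType}.
Let mu := @lebesgue_measure R.

(** Translation of [t] by [ln w]. *)
Lemma integral_log_gamma_scaled (b w : R) : 0 < b -> 0 < w ->
  (\int[mu]_t (expR (b * t - w * expR t))%:E =
   (expR (- (b * ln w)) * log_gamma_mass b)%:E)%E.
Proof.
move=> b0 w0.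
have m b' : measurable_fun [set: measurableTypeR R]
    (fun t => (log_gamma_fun b' t)%:E).
  apply/measurable_EFinP; apply: continuous_measurable_fun.
  exact: continuous_log_gamma_fun.
have lg0 (b' t : R) : (0 <= (log_gamma_fun b' t)%:E)%E by rewrite lee_fin expR_ge0.
transitivity (\int[mu]_t ((expR (- (b * ln w)))%:E *
    (log_gamma_fun b (1 * t + ln w))%:E))%E.
  apply: eq_integral => t _; rewrite -EFinM; congr EFin.
  rewrite /log_gamma_fun -expRD; congr expR.
  by rewrite mul1r expRD lnK ?posrE//; ring.
rewrite ge0_integralZl//.
- rewrite (ge0_integral_affine (ln w) (ltr01 : (0:R) < 1) (m b) (lg0 b)).
  by rewrite invr1 mul1e log_gamma_massE.
- have mT : measurable_fun [set: measurableTypeR R]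
      (fun t : measurableTypeR R => 1 * t + ln w : measurableTypeR R).
    by apply: measurable_funD => //; exact: measurable_funM.
  exact: (measurableT_comp (m b) mT).
Qed.

End log_gamma_scaled.

(** * The Cauchy law as a Gaussian mixture *)

Section omega_facts.
Context {R : realType} {n : nat}.
Implicit Type x : 'rV[R]_n.

Lemma sqr_enormE x : enorm x ^+ 2 = \sum_i x ord0 i ^+ 2.
Proof. by rewrite sqr_sqrtr// sumr_ge0// => i _; exact: sqr_ge0. Qed.

Lemma omega_ge1 x : 1 <= omega x.
Proof. by rewrite lerDl sqr_ge0. Qed.

Lemma omega_gt0 x : 0 < omega x.
Proof. by rewrite (lt_le_trans ltr01)// omega_ge1. Qed.

Lemma gauss_pdf_rVE x : gauss_pdf_rV x =
  (Num.sqrt pi)^-1 ^+ n * expR (- enorm x ^+ 2).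
Proof.
rewrite /gauss_pdf_rV /gauss_pdf big_split/= prodr_const card_ord; congr (_ * _).
by rewrite -expR_sum sqr_enormE sumrN.
Qed.

Lemma enormZ_sqr (l : R) x : enorm (l *: x) ^+ 2 = l ^+ 2 * enorm x ^+ 2.
Proof.
rewrite !sqr_enormE mulr_sumr; apply: eq_bigr => i _.
by rewrite mxE exprMn.
Qed.

End omega_facts.

Section mixture.
Context {R : realType} (n : nat) (beta : R).
Hypothesis beta_gt : n%:R / 2 < beta.
Let mu := @lebesgue_measure R.
Local Notation a := (beta - n%:R / 2)%R.
Let a0 : 0 < a. Proof. by rewrite subr_gt0. Qed.
Variable P : probability (measurableTypeR R) R.
Local Open Scope ereal_scope.
Hypothesis PE : forall phi : R -> \bar R,
  measurable_fun [set: measurableTypeR R] phi -> (forall x, 0 <= phi x) ->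
  \int[P]_x phi x = \int[mu]_x (phi x * (log_gamma_pdf a x)%:E).

Definition mixing_scale (t : R) : R := expR (- t / 2).

(** Up to [joint_const], the density of the pair formed by the log-gamma
    variable t and X = e^(-t/2) Y. *)
Definition joint_density (t : R) (x : 'rV[R]_n) : R :=
  expR (beta * t - omega x * expR t).

Definition joint_const : R := ((log_gamma_mass a)^-1 * (Num.sqrt pi)^-1 ^+ n)%R.

Lemma joint_const_gt0 : (0 < joint_const)%R.
Proof.
by rewrite mulr_gt0 ?exprn_gt0 ?invr_gt0 ?log_gamma_mass_gt0 ?sqrtr_gt0 ?pi_gt0.
Qed.

Lemma measurable_joint_density : measurable_fun setT
  (fun p : measurableTypeR R * 'rV[R]_n => joint_density p.1 p.2).
Proof.
apply: measurableT_comp => //; apply: measurable_funB.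
  exact: measurable_funM.
apply: measurable_funM.
  exact: (measurableT_comp (@measurable_omega R n) measurable_snd).
exact: (measurableT_comp _ measurable_fst).
Qed.

Lemma measurable_mixing : measurable_fun setT
  (fun p : measurableTypeR R * 'rV[R]_n => (mixing_scale p.1 *: p.2)%R).
Proof.
apply/measurable_fun_rVP => i; under eq_fun do rewrite mxE.
apply: measurable_funM.
  have ms : measurable_fun [set: measurableTypeR R] mixing_scale.
    apply: measurableT_comp => //; apply: measurable_funM => //.
  exact: (measurableT_comp ms measurable_fst).
exact: (measurableT_comp (measurable_coord_rV i) measurable_snd).
Qed.

(** The substitution x = e^(-t/2) y: its Jacobian e^(n t/2) raises the
    exponent from beta - n/2 to beta, and the Gaussian factor becomes
    exp(- |x|^2 e^t). *)
Lemma mixture_lawE (phi : measurableTypeR R -> 'rV[R]_n -> \bar R) :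
  measurable_fun setT (fun p : measurableTypeR R * 'rV[R]_n => phi p.1 p.2) ->
  (forall t x, 0 <= phi t x) ->
  \int[P]_t \int[gauss_rV n]_y phi t (mixing_scale t *: y)%R =
  joint_const%:E * \int[lebesgue_rV (n:=n)]_x
    \int[mu]_t (phi t x * (joint_density t x)%:E).
Proof.
move=> mphi phi0.
pose T := (fun p : measurableTypeR R * 'rV[R]_n => (p.1, mixing_scale p.1 *: p.2)%R).
have mT : measurable_fun setT T.
  by apply: measurable_fun_pair => //; exact: measurable_mixing.
have mphiT : measurable_fun setT (fun p : measurableTypeR R * 'rV[R]_n =>
    phi p.1 (mixing_scale p.1 *: p.2)%R).
  exact: (measurableT_comp mphi mT).
have mphit t : measurable_fun setT (phi t).
  exact: (measurableT_comp mphi (pair1_measurable _)).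
pose J (p : measurableTypeR R * 'rV[R]_n) := phi p.1 p.2 * (joint_density p.1 p.2)%:E.
have mJ : measurable_fun setT J.
  apply: emeasurable_funM => //; apply/measurable_EFinP.
  exact: measurable_joint_density.
have J0 p : 0 <= J p by rewrite mule_ge0// lee_fin expR_ge0.
have mJt t : measurable_fun setT (fun x => J (t, x)).
  exact: (measurableT_comp mJ (pair1_measurable _)).
have jointE t x : joint_density t x = (expR (a * t - expR t) *
    expR (n%:R / 2 * t) * expR (- (expR t * enorm x ^+ 2)))%R.
  by rewrite /joint_density -!expRD; congr expR; rewrite /omega; ring.
rewrite PE; first last.
- by move=> t; exact: integral_ge0.
- apply: (measurable_fun_fubini_tonelli_F (fun p : measurableTypeR R * 'rV[R]_n =>
    phi p.1 (mixing_scale p.1 *: p.2)%R)) => //.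
transitivity (\int[mu]_t (joint_const%:E * \int[lebesgue_rV (n:=n)]_x J (t, x))).
  apply: eq_integral => t _.
  have l0 : (0 < mixing_scale t)%R by exact: expR_gt0.
  rewrite gauss_rVE//; last exact: (measurableT_comp (mphit t) (measurable_rVZ _)).
  have mg : measurable_fun setT (fun x : 'rV[R]_n =>
      (gauss_pdf_rV ((mixing_scale t)^-1 *: x)%R)%:E).
    apply/measurable_EFinP.
    exact: (measurableT_comp (@measurable_gauss_pdf_rV R n) (measurable_rVZ _)).
  pose psi x := phi t x * (gauss_pdf_rV ((mixing_scale t)^-1 *: x)%R)%:E.
  rewrite (@eq_integral _ _ _ _ _ (fun y : 'rV[R]_n => psi (mixing_scale t *: y)%R)); last first.
    by move=> y _; rewrite /psi scalerA mulVf ?gt_eqF// scale1r.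
  rewrite (ge0_integral_rVZ l0)//; first last.
  - by move=> x; rewrite mule_ge0// lee_fin ltW// gauss_pdf_rV_gt0.
  - exact: emeasurable_funM.
  rewrite muleC muleA -EFinM.
  rewrite -!ge0_integralZl//; first last.
  - by rewrite lee_fin mulr_ge0// ?invr_ge0 ?exprn_ge0// ltW// log_gamma_pdf_gt0.
  - by move=> x _; rewrite mule_ge0// lee_fin ltW// gauss_pdf_rV_gt0.
  - exact: emeasurable_funM.
  - by rewrite lee_fin ltW// joint_const_gt0.
  apply: eq_integral => x _; rewrite /psi /J/= muleCA [RHS]muleCA; congr (_ * _).
  rewrite -!EFinM; congr EFin.
  rewrite gauss_pdf_rVE enormZ_sqr /log_gamma_pdf /joint_const jointE/=.
  rewrite /log_gamma_fun.
  have -> : ((mixing_scale t)^-1 ^+ 2 = expR t)%R.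
    by rewrite /mixing_scale -expRN expr2 -expRD; congr expR; field.
  have -> : ((mixing_scale t) ^- n = expR (n%:R / 2 * t))%R.
    by rewrite -exprVn /mixing_scale -expRN -expRM_natl; congr expR; field.
  ring.
rewrite ge0_integralZl//; first last.
- by rewrite lee_fin ltW// joint_const_gt0.
- by move=> t _; exact: integral_ge0.
- exact: (measurable_fun_fubini_tonelli_F J).
congr (_ * _); exact: (fubini_tonelli J).
Qed.

Let b0 : (0 < beta)%R.
Proof. by rewrite (le_lt_trans _ beta_gt)// divr_ge0. Qed.

Local Notation K := (joint_const * log_gamma_mass beta)%R.

Let K0 : (0 < K)%R.
Proof. by rewrite mulr_gt0 ?joint_const_gt0// log_gamma_mass_gt0. Qed.

Lemma powR_omegaN (x : 'rV[R]_n) :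
  (omega x `^ (- beta) = expR (- (beta * ln (omega x))))%R.
Proof. by rewrite /powR gt_eqF ?omega_gt0// mulNr. Qed.

Lemma measurable_powR_omega :
  measurable_fun setT (fun x : 'rV[R]_n => omega x `^ (- beta))%R.
Proof. exact: (measurableT_comp (measurable_powR (- beta)) (@measurable_omega R n)). Qed.

Lemma mixture_marginalE (phi : 'rV[R]_n -> \bar R) :
  measurable_fun setT phi -> (forall x, 0 <= phi x) ->
  \int[P]_t \int[gauss_rV n]_y phi (mixing_scale t *: y)%R =
  \int[lebesgue_rV (n:=n)]_x (phi x * (K * omega x `^ (- beta))%R%:E).
Proof.
move=> mphi phi0; rewrite (mixture_lawE (phi := fun _ => phi))//; last first.
  exact: (measurableT_comp mphi measurable_snd).
rewrite -ge0_integralZl//; first last.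
- by rewrite lee_fin ltW// joint_const_gt0.
- by move=> x _; apply: integral_ge0 => t _; rewrite mule_ge0// lee_fin expR_ge0.
- apply: (measurable_fun_fubini_tonelli_G (fun p : measurableTypeR R * 'rV[R]_n =>
    phi p.2 * (joint_density p.1 p.2)%:E)).
  + apply: emeasurable_funM; first exact: (measurableT_comp mphi measurable_snd).
    by apply/measurable_EFinP; exact: measurable_joint_density.
  + by move=> p; rewrite mule_ge0// lee_fin expR_ge0.
apply: eq_integral => x _.
have md : measurable_fun [set: measurableTypeR R] (fun t => (joint_density t x)%:E).
  apply/measurable_EFinP.
  exact: (measurableT_comp measurable_joint_density (pair2_measurable x)).
rewrite ge0_integralZl//; last by move=> t _; rewrite lee_fin expR_ge0.
rewrite (integral_log_gamma_scaled b0 (omega_gt0 x)) powR_omegaN.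
rewrite muleCA -EFinM; congr (_ * _); congr EFin; ring.
Qed.

(** Both sides have a density proportional to the same power of [omega]. As the
    right-hand side has total mass 1, the normalising constants agree. *)
Lemma cauchy_measure_mixtureE (phi : 'rV[R]_n -> \bar R) :
  measurable_fun setT phi -> (forall x, 0 <= phi x) ->
  \int[cauchy_measure beta]_x phi x =
  \int[P]_t \int[gauss_rV n]_y phi (mixing_scale t *: y)%R.
Proof.
move=> mphi phi0.
have mg : measurable_fun setT (fun x : 'rV[R]_n => K * omega x `^ (- beta))%R.
  by apply: measurable_funM => //; exact: measurable_powR_omega.
have g0 (x : 'rV[R]_n) : (0 <= K * omega x `^ (- beta))%R.
  by rewrite mulr_ge0 ?powR_ge0// ltW.
have numE A : measurable A ->
    \int[lebesgue_rV (n:=n)]_(x in A) (K * omega x `^ (- beta))%R%:E =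
    K%:E * cauchy_num beta A.
  move=> mA; under eq_integral do rewrite EFinM.
  rewrite ge0_integralZl//.
  - apply/measurable_EFinP/measurable_funTS; exact: measurable_powR_omega.
  - by move=> x _; rewrite lee_fin powR_ge0.
  - by rewrite lee_fin ltW.
have Z : K%:E * cauchy_num (n:=n) beta setT = 1.
  rewrite -numE//.
  transitivity (\int[P]_t \int[gauss_rV n]_y (cst 1 (mixing_scale t *: y)%R)).
    by rewrite mixture_marginalE//; apply: eq_integral => x _; rewrite mul1e.
  under eq_integral do rewrite probability_integral_cst.
  exact: probability_integral_cst.
have KE : (fine (cauchy_num (n:=n) beta setT))^-1%R = K.
  have c0 : 0 <= cauchy_num (n:=n) beta setT by exact: measure_ge0.
  move: Z c0; case: (cauchy_num _ _) => [r| |]//=.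
  - rewrite -EFinM => -[Kr] _; rewrite -[LHS]mul1r -Kr mulfK//.
    apply/eqP => r0; move: Kr; rewrite r0 mulr0 => /eqP.
    by rewrite eq_sym oner_eq0.
  - by rewrite gt0_muley ?lte_fin.
rewrite mixture_marginalE//.
apply: ge0_integral_density => // A mA.
by rewrite numE// -KE.
Qed.

Lemma cauchy_measure_setT : cauchy_measure (n:=n) beta setT = 1.
Proof.
have := cauchy_measure_mixtureE (phi := cst 1) (measurable_cst 1) (fun _ => lee01).
rewrite integral_cst// mul1e => ->.
under eq_integral do rewrite probability_integral_cst.
exact: probability_integral_cst.
Qed.

End mixture.

(** * The inequality for the mixture *)

Section C1_chain_rule.
Context {R : realType}.

Lemma mvt_between (u du : R -> R) (a b : R) :
  (forall x : R, is_derive x 1 u (du x)) ->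
  exists c, `|c - a| <= `|b - a| /\ u b - u a = du c * (b - a).
Proof.
move=> ud; have cu : continuous u by move=> x; exact: is_derive_continuous (ud x).
have [ab|/ltW ba] := leP a b.
  have [|c] := MVT_segment ab (fun x _ => ud x); first exact: continuous_subspaceT.
  rewrite in_itv/= => /andP[ac cb] e; exists c; split => //.
  by rewrite !ger0_norm ?subr_ge0// lerB.
have [|c] := MVT_segment ba (fun x _ => ud x); first exact: continuous_subspaceT.
rewrite in_itv/= => /andP[bc ca] e; exists c; split.
  by rewrite !ler0_norm ?subr_le0// lerN2 lerB.
by rewrite -opprB e -mulrN opprB.
Qed.

(** The increment [h *: y] is made one coordinate at a time; the mean value
    theorem on each step turns the difference quotient into a sum of partial
    derivatives at points that tend to [z]. *)
Lemma C1_directional n (f : 'rV[R]_n -> R) (D : 'I_n -> 'rV[R]_n -> R) z y :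
  C1_slices f D -> (forall i, continuous (D i)) ->
  is_derive (0 : R) 1 (fun h : R => f (z + h *: y)) (\sum_i y ord0 i * D i z).
Proof.
(* yt k keeps the first k coordinates of y *)
move=> fD cD; pose yt (k : nat) : 'rV[R]_n := \row_i (if (i < k)%N then y ord0 i else 0).
have step (k : 'I_n) (h : R) : z + h *: yt k.+1 =
    z + h *: yt k + (h * y ord0 k) *: delta_mx ord0 k.
  apply/rowP => i; rewrite !mxE/= -addrA; congr (_ + _).
  rewrite ltnS leq_eqVlt; have [->|ik] := eqVneq i k.
    by rewrite eqxx ltnn/= mulr0 add0r mulr1.
  by rewrite (inj_eq val_inj) (negbTE ik)/= mulr0 addr0.
have ex (k : 'I_n) (h : R) : {xi | `|xi| <= `|h * y ord0 k| /\
    f (z + h *: yt k.+1) - f (z + h *: yt k) =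
    D k (z + h *: yt k + xi *: delta_mx ord0 k) * (h * y ord0 k)}.
  apply: cid; have [fd _] := fD k (z + h *: yt k).
  have [xi [xi_le e]] := mvt_between 0 (h * y ord0 k) fd.
  exists xi; rewrite step; move: xi_le e.
  by rewrite !subr0 scale0r addr0.
pose g (h : R) := \sum_k y ord0 k *
  D k (z + h *: yt k + sval (ex k h) *: delta_mx ord0 k).
have g0 : g 0 = \sum_i y ord0 i * D i z.
  apply: eq_bigr => k _; case: (ex k 0) => xi [] /=.
  by rewrite mul0r normr0 normr_le0 => /eqP -> _; rewrite !scale0r !addr0.
apply/is_derive1_caratheodory; exists g; split => //.
  move=> h; rewrite subr0 scale0r addr0 mulrC /g mulr_sumr.
  have -> : f (z + h *: y) - f z =
      \sum_(0 <= k < n) (f (z + h *: yt k.+1) - f (z + h *: yt k)).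
    rewrite telescope_sumr//; congr (f _ - f _).
      by congr (_ + _ *: _); apply/rowP => i; rewrite mxE ltn_ord.
    by rewrite (_ : yt 0%N = 0) ?scaler0 ?addr0//; apply/rowP => i; rewrite !mxE.
  rewrite big_mkord; apply: eq_bigr => k _.
  by case: (ex k h) => xi [] /= _ ->; ring.
rewrite /prop_for /continuous_at g0 /g.
apply: cvg_big => [|k _]; first exact: add_continuous.
have xi0 : sval (ex k h) @[h --> (0 : R)] --> (0 : R).
  have N0 : `|h * y ord0 k| @[h --> (0 : R)] --> (0 : R).
    have C : continuous (fun h : R => `|h * y ord0 k|).
      by move=> h; apply: cvg_norm; apply: cvgMl; exact: cvg_id.
    by have := C 0; rewrite /continuous_at mul0r normr0.
  apply: (@squeeze_cvgr _ _ _ _ (fun h : R => - `|h * y ord0 k|)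
    (fun h : R => `|h * y ord0 k|)) => //.
  - by near=> h; rewrite -ler_norml; case: (ex k h) => xi [].
  - by rewrite -[X in _ --> X]oppr0; apply: cvgN; exact: N0.
apply: cvgMr; apply: continuous_cvg; first exact: cD.
rewrite -[X in _ --> X]addr0; apply: cvgD; last first.
  by rewrite -(scale0r (delta_mx ord0 k)); apply: cvgZl.
rewrite -[X in _ --> X]addr0; apply: cvgD; first exact: cvg_cst.
by rewrite -(scale0r (yt k)); apply: cvgZl; exact: cvg_id.
Unshelve. all: by end_near. Qed.

(** The chain rule along a ray, for the scale mixture. *)
Lemma C1_curve n (f : 'rV[R]_n -> R) (D : 'I_n -> 'rV[R]_n -> R)
    (l : R -> R) (y : 'rV[R]_n) (t dl : R) :
  C1_slices f D -> (forall i, continuous (D i)) -> is_derive t 1 l dl ->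
  is_derive t 1 (fun s => f (l s *: y)) (dl * \sum_i y ord0 i * D i (l t *: y)).
Proof.
move=> fD cD ld.
have Fd := C1_directional (l t *: y) y fD cD.
have sd : is_derive t 1 (fun s => l s - l t) dl.
  by apply: is_derive_eq; rewrite subr0.
rewrite -[X in is_derive X](subrr (l t)) in Fd.
have := @is_derive1_comp _ (fun h => f (l t *: y + h *: y)) (fun s => l s - l t) t _ _ Fd sd.
rewrite (_ : _ \o _ = fun s => f (l s *: y)); last first.
  by apply/funext => s /=; rewrite -scalerDl addrC subrK.
by rewrite mulrC.
Qed.

Lemma smooth_C1_slices n (f : 'rV[R]_n -> R) : smooth f ->
  [/\ continuous f, forall i, continuous (partial i f) &
      C1_slices f (fun i => partial i f)].
Proof.
move=> fs; have [cf df] := fs [::].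
have cD i : continuous (partial i f) by have [] := fs [:: i].
split => // i x; split.
  move=> a; set v := delta_mx ord0 i; pose w (b : R) := f (x + b *: v).
  have qE : (fun h : R => h^-1 *: ((w \o shift a) (h *: 1) - w a)) =
      (fun h : R => h^-1 *: ((f \o shift (x + a *: v)) (h *: v) - f (x + a *: v))).
    apply/funext => h; rewrite /w /= [h *: 1]mulr1 scalerDl; congr (_ *: (f _ - _)).
    by rewrite addrCA.
  have dw := df i (x + a *: v).
  by split; rewrite /derivable /partial /derive qE.
move=> a; apply: continuous_comp; last exact: cD.
apply: cvgD; first exact: cvg_cst.
by apply: cvgZl; exact: cvg_id.
Qed.

End C1_chain_rule.

Section gradient.
Context {R : realType}.

(** From the nonnegativity of the sum of the squares of [S * x i - T * y i]. *)
Lemma cauchy_schwarz_sum n (x y : 'I_n -> R) :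
  (\sum_i x i * y i) ^+ 2 <= (\sum_i x i ^+ 2) * (\sum_i y i ^+ 2).
Proof.
set T := \sum_i x i * y i; set X := \sum_i x i ^+ 2; set S := \sum_i y i ^+ 2.
have S0 : 0 <= S by apply: sumr_ge0 => i _; exact: sqr_ge0.
have : 0 <= \sum_i (S * x i - T * y i) ^+ 2.
  by apply: sumr_ge0 => i _; exact: sqr_ge0.
have -> : \sum_i (S * x i - T * y i) ^+ 2 = S * (X * S - T ^+ 2).
  transitivity (\sum_i (S ^+ 2 * x i ^+ 2 - 2 * S * T * (x i * y i) +
      T ^+ 2 * y i ^+ 2)).
    by apply: eq_bigr => i _; ring.
  rewrite big_split/= sumrB -!mulr_sumr -/T -/X -/S; ring.
have [S_eq0 _|Sn0] := eqVneq S 0; last first.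
  by rewrite pmulr_rge0 ?subr_ge0// lt_neqAle eq_sym Sn0.
have y0 i : y i = 0.
  apply/eqP; rewrite -sqrf_eq0; move/eqP: S_eq0; rewrite psumr_eq0.
    by move=> /allP/(_ i); rewrite mem_index_enum => /(_ isT).
  by move=> j _; exact: sqr_ge0.
rewrite S_eq0 mulr0 /T big1 ?expr0n// => i _; by rewrite y0 mulr0.
Qed.

Lemma sqr_enorm_grad n (f : 'rV[R]_n -> R) x :
  enorm (grad f x) ^+ 2 = \sum_i partial i f x ^+ 2.
Proof. by rewrite sqr_enormE; apply: eq_bigr => i _; rewrite mxE. Qed.

Lemma compactly_supported_bounded n (f : 'rV[R]_n -> R) :
  continuous f -> compactly_supported f -> exists M, forall x, `|f x| <= M.
Proof.
move=> cf cs.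
have : compact (f @` closure [set x | f x != 0]).
  by apply: continuous_compact => //; exact: continuous_subspaceT.
move=> /compact_bounded[M [_ Mb]].
exists (`|M| + 1) => x.
have [->|fx] := eqVneq (f x) 0; first by rewrite normr0 addr_ge0.
apply: (Mb (`|M| + 1)); first by rewrite (le_lt_trans (ler_norm M))// ltrDl.
by exists x => //; exact: subset_closure.
Qed.

End gradient.

Section product_lsi.
Context {R : realType}.
Variables (n : nat) (a : R) (P : probability (measurableTypeR R) R).
Hypothesis a0 : 0 < a.
Hypothesis PE : forall phi : R -> \bar R,
  measurable_fun [set: measurableTypeR R] phi -> (forall x, 0 <= phi x)%E ->
  (\int[P]_x phi x = \int[lebesgue_measure]_x (phi x * (log_gamma_pdf a x)%:E))%E.
Variables (f : 'rV[R]_n -> R) (D : 'I_n -> 'rV[R]_n -> R) (M eps : R).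
Hypotheses (eps0 : 0 < eps) (fM : forall x, `|f x| <= M).
Hypotheses (cf : continuous f) (cD : forall i, continuous (D i)).
Hypothesis fD : C1_slices f D.

(** The energy at x = e^(-t/2) y of the product law: the radial term comes from
    the derivative in t, the second one from the gradient in y. *)
Definition mixture_energy (t : R) (x : 'rV[R]_n) : R :=
  log_gamma_weight a t / a * (\sum_i x ord0 i * D i x) ^+ 2 +
  expR (- t) * \sum_i D i x ^+ 2.

Let w0 t : 0 <= log_gamma_weight a t.
Proof. by rewrite (le_trans _ (log_gamma_weight_ge1 a0 t)). Qed.

Let mw : measurable_fun [set: measurableTypeR R] (log_gamma_weight a).
Proof.
apply: continuous_measurable_fun => t.
exact: is_derive_continuous (is_derive_log_gamma_weight a t).
Qed.

Let me : measurable_fun [set: measurableTypeR R] (fun t : R => expR (- t)).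
Proof. by apply: measurableT_comp. Qed.

Lemma mixture_energy_ge0 t x : 0 <= mixture_energy t x.
Proof.
rewrite addr_ge0// mulr_ge0 ?sqr_ge0 ?expR_ge0//; first by rewrite divr_ge0// ltW.
by apply: sumr_ge0 => i _; exact: sqr_ge0.
Qed.

Lemma mixture_energy_le t x : mixture_energy t x <=
  (a^-1 * log_gamma_weight a t * omega x + expR (- t)) * \sum_i D i x ^+ 2.
Proof.
rewrite /mixture_energy [leRHS]mulrDl lerD2r -!mulrA mulrCA.
rewrite ler_wpM2l ?invr_ge0 ?(ltW a0)// ler_wpM2l//.
apply: (le_trans (cauchy_schwarz_sum _ _)); apply: ler_wpM2r.
  by apply: sumr_ge0 => i _; exact: sqr_ge0.
by rewrite -sqr_enormE lerDr.
Qed.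

Lemma measurable_mixture_energy : measurable_fun setT
  (fun p : measurableTypeR R * 'rV[R]_n => mixture_energy p.1 p.2).
Proof.
have mD (i : 'I_n) := measurableT_comp (continuous_measurable_rV (@cD i))
  (@measurable_snd _ _ (measurableTypeR R) 'rV[R]_n).
apply: measurable_funD.
  apply: measurable_funM.
    by apply: measurable_funM => //; exact: (measurableT_comp mw measurable_fst).
  apply: measurable_funX; apply: measurable_sum => i; apply: measurable_funM.
    exact: (measurableT_comp (measurable_coord_rV i) measurable_snd).
  exact: mD.
apply: measurable_funM; first exact: (measurableT_comp me measurable_fst).
by apply: measurable_sum => i; apply: measurable_funX; exact: mD.
Qed.

Lemma mixing_scale_sqr t : mixing_scale t ^+ 2 = expR (- t) :> R.
Proof. by rewrite /mixing_scale expr2 -expRD; congr expR; field. Qed.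

Lemma is_derive_mixing_scale (t : R) :
  is_derive t 1 mixing_scale (- (1 / 2) * mixing_scale t).
Proof.
by rewrite /mixing_scale; apply: is_derive_eq; rewrite /GRing.scale/=; field.
Qed.

Lemma C1_slices_scale (l : R) :
  C1_slices (fun y => f (l *: y)) (fun i y => l * D i (l *: y)).
Proof.
move=> i y; have [fd cd] := fD i (l *: y).
have E b : l *: (y + b *: delta_mx ord0 i) = l *: y + (b * l) *: delta_mx ord0 i.
  by rewrite scalerDr scalerA (mulrC l).
split=> [b|].
  rewrite E (mulrC l (D _ _)).
  rewrite (_ : (fun _ => _) =
    (fun c => f (l *: y + c *: delta_mx ord0 i)) \o (fun b => b * l)); last first.
    by apply/funext => c; rewrite /= E.
  have ld : is_derive b 1 (fun b : R => b * l) l.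
    by apply: is_derive_eq; rewrite /GRing.scale/=; ring.
  have fdl := fd (b * l).
  exact: (@is_derive1_comp _ _ (fun b : R => b * l)).
rewrite (_ : (fun _ => _) = fun b =>
    l * D i (l *: y + (b * l) *: delta_mx ord0 i)); last first.
  by apply/funext => b; rewrite E.
apply: continuous_mul; first exact: continuous_const.
move=> b; apply: (@continuous_comp R R R (fun b => b * l)
  (fun c => D i (l *: y + c *: delta_mx ord0 i))); last exact: cd.
by apply: cvgMl; exact: cvg_id.
Qed.

(** Tensorization for the log-gamma law of t and the Gaussian law of y,
    applied to the function of (t, y) that sends it to f(e^(-t/2) y). *)
Lemma mixture_lsi (c : R) :
  (\int[P]_t \int[gauss_rV n]_y (f (mixing_scale t *: y) ^+ 2 + eps)%:E = c%:E)%E ->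
  (\int[P]_t \int[gauss_rV n]_y
     (bregman (f (mixing_scale t *: y) ^+ 2 + eps) c)%:E <=
   \int[P]_t \int[gauss_rV n]_y
     (mixture_energy t (mixing_scale t *: y))%:E)%E.
Proof.
move=> cE.
have mf := continuous_measurable_rV cf.
have mD (i : 'I_n) := continuous_measurable_rV (@cD i).
have mfm := measurableT_comp mf (@measurable_mixing R n).
have mDm (i : 'I_n) := measurableT_comp (mD i) (@measurable_mixing R n).
pose drift t (x : 'rV[R]_n) :=
  log_gamma_weight a t / a * (\sum_i x ord0 i * D i x) ^+ 2.
pose noise (t : R) (x : 'rV[R]_n) := expR (- t) * \sum_i D i x ^+ 2.
pose h (t : measurableTypeR R) (y : 'rV[R]_n) := f (mixing_scale t *: y) ^+ 2 + eps.
apply: (@entropy_gap_tensor _ _ _ _ _ P (gauss_rV n) h eps (M ^+ 2 + eps)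
  (fun t y => (drift t (mixing_scale t *: y))%:E)
  (fun t y => (noise t (mixing_scale t *: y))%:E)) => //.
- exact: (measurable_sqr_eps _ mfm).
- by move=> t y; rewrite lerDr sqr_ge0.
- by move=> t y; exact: sqr_eps_le.
- apply/measurable_EFinP; apply: measurable_funM.
    apply: measurable_funM => //; exact: (measurableT_comp mw measurable_fst).
  apply: measurable_funX; apply: measurable_sum => i; apply: measurable_funM.
    exact: (measurableT_comp (measurable_coord_rV i) (@measurable_mixing R n)).
  exact: mDm.
- apply/measurable_EFinP; apply: measurable_funM.
    exact: (measurableT_comp me measurable_fst).
  apply: measurable_sum => i; apply: measurable_funX; exact: mDm.
- by move=> t y; rewrite lee_fin mulr_ge0 ?sqr_ge0// divr_ge0// ltW.
- move=> t y; rewrite lee_fin mulr_ge0 ?expR_ge0// sumr_ge0// => i _.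
  exact: sqr_ge0.
- move=> y.
  pose du (t : R) := - (1 / 2) * mixing_scale t *
    \sum_i y ord0 i * D i (mixing_scale t *: y).
  have cm : continuous (@mixing_scale R).
    by move=> t; exact: is_derive_continuous (is_derive_mixing_scale t).
  have cdu : continuous du.
    apply: continuous_mul.
      by apply: continuous_mul; [exact: continuous_const|exact: cm].
    move=> t; apply: cvg_big => [|i _]; first exact: add_continuous.
    apply: cvgMr; apply: continuous_cvg; first exact: cD.
    by apply: cvgZl; exact: cm.
  have ud (t : R) : is_derive t 1 (fun t => f (mixing_scale t *: y)) (du t).
    exact: (C1_curve y fD cD (is_derive_mixing_scale t)).
  have uM t : `|f (mixing_scale t *: y)| <= M by [].
  have mdu : measurable_fun [set: measurableTypeR R]
      (fun t => (log_gamma_weight a t * du t ^+ 2)%:E).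
    apply/measurable_EFinP; apply: measurable_funM => //; apply: measurable_funX.
    exact: continuous_measurable_fun.
  apply: (le_trans (log_gamma_lsi a0 PE eps0 uM ud cdu)).
  rewrite -ge0_integralZl//; first last.
  - by rewrite lee_fin divr_ge0// ltW.
  - by move=> t _; rewrite lee_fin mulr_ge0// sqr_ge0.
  rewrite le_eqVlt; apply/orP; left; apply/eqP; apply: eq_integral => t _.
  rewrite -EFinM; congr EFin; rewrite /drift /du.
  have -> : \sum_i (mixing_scale t *: y) ord0 i * D i (mixing_scale t *: y) =
      mixing_scale t * \sum_i y ord0 i * D i (mixing_scale t *: y).
    by rewrite mulr_sumr; apply: eq_bigr => i _; rewrite mxE mulrA.
  by field; rewrite gt_eqF.
- move=> t.
  apply: (le_trans (gauss_rV_lsi (M := M) eps0 _ _ _ (C1_slices_scale (mixing_scale t)))).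
  + exact: (measurableT_comp mf (measurable_rVZ _)).
  + by [].
  + by move=> i; apply: measurable_funM => //;
      exact: (measurableT_comp (mD i) (measurable_rVZ _)).
  rewrite le_eqVlt; apply/orP; left; apply/eqP; apply: eq_integral => y _.
  congr EFin; rewrite /noise mulr_sumr; apply: eq_bigr => i _.
  by rewrite exprMn mixing_scale_sqr.
Qed.

End product_lsi.

(** * The conditional mean of the energy *)

Section weight_integral.
Context {R : realType} (n : nat) (beta : R).
Hypotheses (n_ge3 : (3 <= n)%N) (beta_gt : n%:R / 2 < beta).
Hypothesis beta_le : beta <= n%:R - 1.
Let mu := @lebesgue_measure R.
Local Notation a := (beta - n%:R / 2).

Let n3 : (3 : R) <= n%:R. Proof. by rewrite ler_nat. Qed.
Let a0 : 0 < a. Proof. by rewrite subr_gt0. Qed.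
Let b10 : 0 < beta - 1. Proof. by have := a0; have := n3; lra. Qed.

(** With q = (beta-1) e^(-t)/w and k = (a+1)/(beta-1) <= 2 one has
    ln(a+1) - t = ln w + ln q + ln k, where ln q <= q - 1 and ln k <= 1. The
    point of tangency in q is the conditional mean of e^(-t), so that q has mean
    1 after integration. *)
Lemma log_gamma_weight_le (w t : R) : 0 < w ->
  log_gamma_weight a t <=
  ln w + (beta - 1) * expR (- t) / w + expR t / (a + 1).
Proof.
move=> w0; rewrite /log_gamma_weight lerD2r.
have a10 : 0 < a + 1 by have := a0; lra.
pose q := (beta - 1) * expR (- t) / w.
have q0 : 0 < q by rewrite divr_gt0// mulr_gt0// expR_gt0.
pose k := (a + 1) / (beta - 1).
have k0 : 0 < k by rewrite divr_gt0.
have k2 : k <= 2 by rewrite ler_pdivrMr//; have := n3; have := beta_gt; lra.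
have -> : ln (a + 1) - t = ln w + (ln q + ln k).
  rewrite -lnM ?posrE//.
  have -> : q * k = (a + 1) * expR (- t) / w.
    by rewrite /q /k; set A := a; field; rewrite !gt_eqF.
  by rewrite ln_div ?posrE ?mulr_gt0 ?expR_gt0// lnM ?posrE ?expR_gt0// expRK; ring.
have lq := ln_le_subr1 q0.
have lk := ln_le_subr1 k0.
rewrite -/q; lra.
Qed.

Local Notation I b w := (expR (- (b * ln w)) * log_gamma_mass b).

Lemma weight_integrand_ge0 (w t : R) : 0 < w ->
  0 <= (a^-1 * log_gamma_weight a t * w + expR (- t)) *
    expR (beta * t - w * expR t).
Proof.
move=> w0; rewrite mulr_ge0 ?expR_ge0// addr_ge0 ?expR_ge0//.
rewrite mulr_ge0 ?(ltW w0)// mulr_ge0 ?invr_ge0 ?(ltW a0)//.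
by rewrite (le_trans _ (log_gamma_weight_ge1 a0 t)).
Qed.

Lemma measurable_weight_integrand (w : R) : measurable_fun [set: measurableTypeR R]
  (fun t => ((a^-1 * log_gamma_weight a t * w + expR (- t)) *
    expR (beta * t - w * expR t))%:E).
Proof.
apply/measurable_EFinP; apply: continuous_measurable_fun; apply: continuous_mul.
  apply: continuous_add.
    apply: continuous_mul; last exact: continuous_const.
    apply: continuous_mul; first exact: continuous_const.
    by move=> t; exact: is_derive_continuous (is_derive_log_gamma_weight a t).
  move=> t; apply: continuous_comp; last exact: continuous_expR.
  by apply: cvgN; exact: cvg_id.
move=> t; apply: continuous_comp; last exact: continuous_expR.
apply: continuousB; first by apply: cvgMr; exact: cvg_id.
by apply: cvgMr; exact: continuous_expR.
Qed.

(** The mean of a^(-1) w(t) omega + e^(-t) for the unnormalised conditional law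
    of t given omega(X) = w. After [log_gamma_weight_le] only the moments of
    e^(-t) and e^t occur, and these come from the functional equation of the
    Gamma function. *)
Lemma weight_integral_le (w : R) : 1 <= w ->
  (\int[mu]_t ((a^-1 * log_gamma_weight a t * w + expR (- t)) *
      expR (beta * t - w * expR t))%:E <=
   (2 / a * w * ((n%:R - 2) / a + ln w) * (I beta w))%:E)%E.
Proof.
move=> w1; have w0 : 0 < w by rewrite (lt_le_trans ltr01).
have lw : 0 <= ln w by exact: ln_ge0.
have a10 : 0 < a + 1 by have := a0; lra.
have b0 : 0 < beta by have := b10; lra.
pose k0 := w * ln w / a; pose k1 := (beta - 1) / a + 1; pose k2 := w / (a * (a + 1)).
have k00 : 0 <= k0 by rewrite divr_ge0 ?(ltW a0)// mulr_ge0// ltW.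
have k10 : 0 <= k1 by rewrite addr_ge0// divr_ge0 ?(ltW a0) ?(ltW b10).
have k20 : 0 <= k2 by rewrite divr_ge0 ?(ltW w0)// mulr_ge0 ?(ltW a0) ?(ltW a10).
pose E b t := expR (b * t - w * expR t).
have E0 b t : 0 <= E b t by exact: expR_ge0.
have mE b : measurable_fun [set: measurableTypeR R] (fun t => (E b t)%:E).
  apply/measurable_EFinP; apply: continuous_measurable_fun => t.
  apply: continuous_comp; last exact: continuous_expR.
  apply: continuousB; first by apply: cvgMr; exact: cvg_id.
  by apply: cvgMr; exact: continuous_expR.
have mkE k b : measurable_fun [set: measurableTypeR R] (fun t => k%:E * (E b t)%:E)%E.
  by apply: measurable_funeM; exact: mE.
have kE0 k b t : 0 <= k -> (0 <= k%:E * (E b t)%:E)%E.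
  by move=> k_ge0; rewrite mule_ge0// lee_fin.
have IE b : 0 < b -> (\int[mu]_t (E b t)%:E = (I b w)%:E)%E.
  by move=> b_gt0; exact: integral_log_gamma_scaled.
apply: (@le_trans _ _ (\int[mu]_t (k0%:E * (E beta t)%:E +
    k1%:E * (E (beta - 1) t)%:E + k2%:E * (E (beta + 1) t)%:E))%E).
  apply: ge0_le_integral => //.
  - by move=> t _; rewrite lee_fin; exact: weight_integrand_ge0.
  - exact: measurable_weight_integrand.
  - by apply: emeasurable_funD; [apply: emeasurable_funD|]; exact: mkE.
  - move=> t _; rewrite -!EFinM -!EFinD lee_fin.
    have -> : E (beta - 1) t = expR (- t) * E beta t.
      by rewrite /E -expRD; congr expR; ring.
    have -> : E (beta + 1) t = expR t * E beta t.
      by rewrite /E -expRD; congr expR; ring.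
    rewrite -/(E beta t) !mulrA -!mulrDl ler_wpM2r//.
    have := ler_wpM2l (ltW w0) (log_gamma_weight_le t w0).
    have ia0 : 0 <= a^-1 by rewrite invr_ge0 ltW.
    move/(ler_wpM2l ia0).
    have -> : a^-1 * (w * (ln w + (beta - 1) * expR (- t) / w + expR t / (a + 1))) =
        k0 + (beta - 1) / a * expR (- t) + k2 * expR t.
      rewrite /k0 /k2; have A0 := a0; have A1 := a10.
      by set A := a in A0 A1 *; field; rewrite !gt_eqF.
    rewrite /k1; set A := a.
    set W := log_gamma_weight A t; move: W => W.
    have -> : A^-1 * (w * W) = A^-1 * W * w by ring.
    set X := A^-1 * W * w; move: X => X Xle.
    set Y := (beta - 1) / A in Xle *; move: Y Xle => Y.
    by rewrite mulrDl mul1r; lra.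
rewrite ge0_integralD//; first last.
- by move=> t _; exact: kE0.
- by apply: emeasurable_funD; exact: mkE.
- by move=> t _; rewrite adde_ge0// kE0.
rewrite ge0_integralD//; first last.
- by move=> t _; exact: kE0.
- by move=> t _; exact: kE0.
have ZE k b : 0 <= k -> (\int[mu]_t (k%:E * (E b t)%:E) =
    k%:E * \int[mu]_t (E b t)%:E)%E.
  by move=> k_ge0; rewrite ge0_integralZl// => t _; rewrite lee_fin.
rewrite !ZE//.
rewrite !IE//; last by rewrite addr_gt0.
rewrite -!EFinM -!EFinD lee_fin.
have I1 : I (beta - 1) w = w / (beta - 1) * (I beta w).
  have := log_gamma_massS b10; rewrite subrK => ->.
  have -> : - ((beta - 1) * ln w) = - (beta * ln w) + ln w by ring.
  by rewrite expRD lnK ?posrE//; field; rewrite gt_eqF.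
have I2 : I (beta + 1) w = beta / w * (I beta w).
  rewrite log_gamma_massS//.
  have -> : - ((beta + 1) * ln w) = - (beta * ln w) - ln w by ring.
  by rewrite [expR (_ - ln w)]expRD (expRN (ln w)) lnK ?posrE//; field; rewrite gt_eqF.
have I0 : 0 <= (I beta w).
  by rewrite mulr_ge0 ?expR_ge0// ltW// log_gamma_mass_gt0.
rewrite I1 I2; move: (I beta w) I0 {I1 I2} => J J0.
rewrite !mulrA -!mulrDl; apply: (ler_wpM2r J0).
have -> : k0 + k1 * w / (beta - 1) + k2 * beta / w = w / a *
    (ln w + 1 + a / (beta - 1) + beta / ((a + 1) * w)).
  rewrite /k0 /k1 /k2; have A0 := a0; have A1 := a10.
  by set A := a in A0 A1 *; field; rewrite !gt_eqF.
have -> : 2 / a * w * ((n%:R - 2) / a + ln w) =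
    w / a * (2 * ((n%:R - 2) / a) + 2 * ln w).
  by have A0 := a0; set A := a in A0 *; field; rewrite gt_eqF.
rewrite ler_wpM2l ?divr_ge0 ?(ltW w0) ?(ltW a0)//.
(* equivalent to beta <= n - 1, and so is r4 *)
have r1 : a / (beta - 1) <= 1 / 2.
  by rewrite ler_pdivrMr//; have := beta_le; lra.
have r2 : beta / ((a + 1) * w) <= beta / (a + 1).
  by rewrite ler_wpM2l ?(ltW b0)// lef_pV2 ?posrE ?mulr_gt0// ler_peMr// ltW.
have r3 : beta / (a + 1) <= 1 + (n%:R - 2) / a / 2.
  rewrite ler_pdivrMr//.
  have -> : (1 + (n%:R - 2) / a / 2) * (a + 1) =
      a + 1 + (n%:R - 2) / 2 + (n%:R - 2) / a / 2.
    by have A0 := a0; set A := a in A0 *; field; rewrite gt_eqF.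
  have : 0 <= (n%:R - 2) / a / 2.
    by rewrite !divr_ge0 ?(ltW a0)//; have := n3; lra.
  lra.
have r4 : 2 <= (n%:R - 2) / a by rewrite ler_pdivlMr//; have := beta_le; lra.
lra.
Qed.

End weight_integral.

Theorem theorem4p3 (R : realType) (n : nat) (beta sigma : R)
  (n_ge3 : (3 <= n)%N)
  (beta_gt : n%:R / 2 < beta) (beta_le : beta <= n%:R - 1)
  (sigma_gt0 : 0 < sigma)
  (ln_sigma : ln sigma = 2 * (n%:R - 2) / (2 * beta - n%:R))
  (f : 'rV[R]_n -> R)
  (f_smooth : smooth f) (f_supp : compactly_supported f) :
  (entropy (cauchy_measure beta) (fun x => f x ^+ 2)%R <=
   (4 / (2 * beta - n%:R))%:E *
   \int[cauchy_measure beta]_x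
     (enorm (grad f x) ^+ 2 * omega x * (ln sigma + ln (omega x)))%:E)%E.
Proof.
have a0 : 0 < beta - n%:R / 2 by rewrite subr_gt0.
have [P PE] := log_gamma_law_exists a0.
have [cf cD fD] := smooth_C1_slices f_smooth.
have [M fM] := compactly_supported_bounded cf f_supp.
have mf := continuous_measurable_rV cf.
have mD i := continuous_measurable_rV (cD i).
pose prob := Measure_isProbability.Build _ _ R (@cauchy_measure R n beta)
  (cauchy_measure_setT beta_gt PE).
pose Pc : probability 'rV[R]_n R := HB.pack (@cauchy_measure R n beta) prob.
have f2M x : f x ^+ 2 <= M ^+ 2 by have := sqr_eps_le 0 (fM x); rewrite !addr0.
apply: (@entropy_le_of_gap R _ _ Pc (fun x => f x ^+ 2) (M ^+ 2)) => //.
- exact: measurable_funX.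
- by move=> x; exact: sqr_ge0.
move=> e e0; pose h x := f x ^+ 2 + e.
have mh : measurable_fun setT h by exact: measurable_sqr_eps.
have h_ge x : e <= h x by rewrite lerDr sqr_ge0.
have h_le x : h x <= M ^+ 2 + e by exact: sqr_eps_le.
have h0 x : 0 < h x by rewrite (lt_le_trans e0).
rewrite /entropy_gap; set c := Rintegral _ _ _.
have c0 : 0 < c by exact: (@mean_gt0 _ _ _ Pc h e (M ^+ 2 + e)).
have cE : (\int[Pc]_x (h x)%:E = c%:E)%E.
  exact: (@meanE _ _ _ Pc h e (M ^+ 2 + e)).
have cE' : (\int[P]_t \int[gauss_rV n]_y
    (f (mixing_scale t *: y) ^+ 2 + e)%:E = c%:E)%E.
  rewrite -cE; apply/esym.
  apply: (cauchy_measure_mixtureE beta_gt PE (phi := fun x => (h x)%:E)).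
  - exact/measurable_EFinP.
  - by move=> x; rewrite lee_fin ltW.
have -> : (\int[Pc]_x (bregman (h x) c)%:E = \int[P]_t \int[gauss_rV n]_y
    (bregman (f (mixing_scale t *: y) ^+ 2 + e) c)%:E)%E.
  apply: (cauchy_measure_mixtureE beta_gt PE (phi := fun x => (bregman (h x) c)%:E)).
  - by apply/measurable_EFinP; exact: measurable_bregman.
  - by move=> x; rewrite lee_fin bregman_ge0.
apply: (le_trans (mixture_lsi a0 PE e0 fM cf cD fD cE')).
(* the energy is rewritten in terms of (t, X), with t integrated out first *)
pose En := mixture_energy (beta - n%:R / 2) (fun i => partial i f).
have En0 t x : 0 <= En t x by exact: mixture_energy_ge0.
have mEn : measurable_fun setT (fun p : measurableTypeR R * 'rV[R]_n => En p.1 p.2).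
  exact: measurable_mixture_energy.
rewrite (mixture_lawE beta_gt PE (phi := fun t x => (En t x)%:E)); first last.
- by move=> t x; rewrite lee_fin.
- exact/measurable_EFinP.
have S0 x : 0 <= enorm (grad f x) ^+ 2 by exact: sqr_ge0.
have ls0 : 0 <= ln sigma.
  have : (3 : R) <= n%:R by rewrite ler_nat.
  by move=> n3; rewrite ln_sigma divr_ge0//; lra.
have mS : measurable_fun setT (fun x => enorm (grad f x) ^+ 2).
  under eq_fun do rewrite sqr_enorm_grad.
  by apply: measurable_sum => i; exact: measurable_funX.
have mo := @measurable_omega R n.
have mrhs : measurable_fun setT (fun x =>
    (enorm (grad f x) ^+ 2 * omega x * (ln sigma + ln (omega x)))%:E).
  apply/measurable_EFinP; apply: measurable_funM; first exact: measurable_funM.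
  apply: measurable_funD => //; apply: measurableT_comp; first exact: measurable_ln.
  exact: mo.
have rhs0 x : 0 <= enorm (grad f x) ^+ 2 * omega x * (ln sigma + ln (omega x)).
  rewrite mulr_ge0//; first by rewrite mulr_ge0// ltW// omega_gt0.
  by rewrite addr_ge0// ln_ge0// omega_ge1.
rewrite (cauchy_measure_mixtureE beta_gt PE mrhs)//.
rewrite (mixture_marginalE beta_gt PE mrhs)//.
pose S x := enorm (grad f x) ^+ 2.
pose C := joint_const n beta; have C0 : 0 < C by exact: joint_const_gt0.
have jE t x : joint_density beta t x = expR (beta * t - omega x * expR t) by [].
pose J (p : measurableTypeR R * 'rV[R]_n) :=
  ((En p.1 p.2)%:E * (joint_density beta p.1 p.2)%:E)%E.
have mJ : measurable_fun setT J.
  apply: emeasurable_funM; apply/measurable_EFinP => //.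
  exact: measurable_joint_density.
have J0 p : (0 <= J p)%E.
  by rewrite mule_ge0 ?lee_fin ?En0//; exact: expR_ge0.
have mI := measurable_fun_fubini_tonelli_G (m1 := lebesgue_measure) J mJ J0.
rewrite -(ge0_integralZl (lebesgue_rV (n:=n)) measurableT mI); first last.
- by rewrite lee_fin ltW.
- by move=> x _; exact: integral_ge0.
have mphi : measurable_fun setT (fun x =>
    (enorm (grad f x) ^+ 2 * omega x * (ln sigma + ln (omega x)))%:E *
    (C * log_gamma_mass beta * omega x `^ (- beta))%:E)%E.
  apply: emeasurable_funM => //; apply/measurable_EFinP.
  by apply: measurable_funM => //; exact: measurable_powR_omega.
have b0 : 0 < beta by rewrite (le_lt_trans _ beta_gt)// divr_ge0.
have K0 : 0 < C * log_gamma_mass beta by rewrite mulr_gt0// log_gamma_mass_gt0.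
have phi0 x : (0 <= (enorm (grad f x) ^+ 2 * omega x * (ln sigma + ln (omega x)))%:E *
    (C * log_gamma_mass beta * omega x `^ (- beta))%:E)%E.
  by rewrite mule_ge0 ?lee_fin// mulr_ge0 ?powR_ge0// ltW.
have d0 : 0 < 2 * beta - n%:R by have := a0; lra.
rewrite -(ge0_integralZl (lebesgue_rV (n:=n)) measurableT mphi); first last.
- by rewrite lee_fin divr_ge0// ltW.
- by move=> x _.
apply: ge0_le_integral => //.
- by move=> x _; rewrite mule_ge0 ?lee_fin ?(ltW C0)//; exact: integral_ge0.
- exact: measurable_funeM.
- exact: measurable_funeM.
move=> x _; rewrite /fubini_G /J/=.
have w1 := omega_ge1 x.
have w0 := omega_gt0 x.
have le1 : (\int[lebesgue_measure]_t ((En t x)%:E * (joint_density beta t x)%:E) <=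
    (S x)%:E * (2 / (beta - n%:R / 2) * omega x *
      ((n%:R - 2) / (beta - n%:R / 2) + ln (omega x)) *
      (expR (- (beta * ln (omega x))) * log_gamma_mass beta))%:E)%E.
  apply: (le_trans _ (lee_wpmul2l _ (weight_integral_le n_ge3 beta_gt beta_le w1)));
    last by rewrite lee_fin; exact: S0.
  rewrite -ge0_integralZl//; first last.
  - by rewrite lee_fin; exact: S0.
  - move=> t _; rewrite lee_fin; exact: weight_integrand_ge0.
  - exact: measurable_weight_integrand.
  apply: ge0_le_integral => //.
  - by move=> t _; have := J0 (t, x).
  - exact: (measurableT_comp mJ (pair2_measurable x)).
  - by apply: measurable_funeM; exact: measurable_weight_integrand.
  - move=> t _; rewrite -!EFinM lee_fin jE mulrA ler_wpM2r ?expR_ge0//.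
    rewrite mulrC /S sqr_enorm_grad.
    exact: mixture_energy_le.
apply: (le_trans (lee_wpmul2l _ le1)); first by rewrite lee_fin ltW.
rewrite -!EFinM lee_fin powR_omegaN ln_sigma.
set A := beta - n%:R / 2 in a0 *.
have dE : 2 * beta - n%:R = 2 * A by rewrite /A; field.
have -> : 2 * (n%:R - 2) / (2 * beta - n%:R) = (n%:R - 2) / A.
  by rewrite dE; field; rewrite gt_eqF.
have -> : 4 / (2 * beta - n%:R) = 2 / A.
  by rewrite dE; field; rewrite gt_eqF.
rewrite le_eqVlt; apply/orP; left; apply/eqP; rewrite /S /C; ring.
Qed.
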